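(* Let $f$ be an entire function in $\mathcal{E}_m$. There exists an entire function $S(f)\in\mathcal{E}_m$ such that $S(f)$ is square free and an irreducible element $P$ of $\mathcal{E}_m$ divides $S(f)$ if and only if $P$ divides $f$.
   Context: $\mathbf{F}$ is an algebraically closed field (of arbitrary characteristic) complete with respect to a non-Archimedean absolute value. $\mathcal{E}_m$ is the ring of formal power series in $m$ variables over $\mathbf{F}$ with infinite radius of convergence (entire functions on $\mathbf{F}^m$). Its units are the nonzero constants; $P$ is irreducible if it is a nonunit and any factorization $P=gh$ in $\mathcal{E}_m$ has $g$ or $h$ a unit. An element is square free if it is not divisible by $g^2$ for any nonconstant $g\in\mathcal{E}_m$.
   Formalization: The entire function f is assumed to be nonzero; for f = 0 and m ≥ 1 every z_1 − a divides f, which forces S(f) = 0, and 0 is divisible by z_1^2, so it is not square free. *)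

(* Defs.v *)
From HB Require Import structures.
From mathcomp Require Import all_boot all_order all_algebra.
From mathcomp Require Import boolp reals.
From mathcomp Require Import mpoly.

Set Implicit Arguments.
Unset Strict Implicit.
Unset Printing Implicit Defensive.

Import Order.TTheory GRing.Theory Num.Theory.
Local Open Scope ring_scope.

Record nonarch_absval (R : realType) (F : fieldType) := NonarchAbsval {
  absval :> F -> R;
  absval_ge0 : forall x, 0 <= absval x;
  absval_eq0 : forall x, absval x = 0 <-> x = 0;
  absvalM : forall x y, absval (x * y) = absval x * absval y;
  absvalD_max : forall x y,
    absval (x + y) <= Num.max (absval x) (absval y)
}.

Definition absval_cauchy (R : realType) (F : fieldType)
    (v : nonarch_absval R F) (u : nat -> F) : Prop :=
  forall e : R, 0 < e -> exists N : nat, forall i j : nat,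
    (N <= i)%N -> (N <= j)%N -> v (u i - u j) < e.

Definition absval_cvg (R : realType) (F : fieldType)
    (v : nonarch_absval R F) (u : nat -> F) (l : F) : Prop :=
  forall e : R, 0 < e -> exists N : nat, forall i : nat,
    (N <= i)%N -> v (u i - l) < e.

Definition absval_complete (R : realType) (F : fieldType)
    (v : nonarch_absval R F) : Prop :=
  forall u : nat -> F, absval_cauchy v u -> exists l : F, absval_cvg v u l.

Section AbsvalTheory.
Variables (R : realType) (F : fieldType) (v : nonarch_absval R F).

Lemma absval0 : v 0 = 0.
Proof. by apply/absval_eq0. Qed.

Lemma absval1 : v 1 = 1.
Proof.
have v1 : v 1 != 0.
  by apply/eqP => /absval_eq0 /eqP; rewrite oner_eq0.
by apply: (mulfI v1); rewrite -absvalM !mulr1.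
Qed.

Lemma absvalN x : v (- x) = v x.
Proof.
have vN1 : v (-1) = 1.
  apply/eqP; rewrite -(@eqrXn2 _ 2%N) ?ler01 ?absval_ge0 //.
  by rewrite expr1n expr2 -absvalM mulrNN mulr1 absval1.
by rewrite -mulN1r absvalM vN1 mul1r.
Qed.

Lemma absval_sum_lt (I : finType) (P : pred I) (E : I -> F) (e : R) :
  0 < e -> (forall i, P i -> v (E i) < e) -> v (\sum_(i | P i) E i) < e.
Proof.
move=> e0 vE; elim/big_ind: _ => //; first by rewrite absval0.
move=> x y xe ye; apply: le_lt_trans (absvalD_max v x y) _.
by rewrite gt_max xe ye.
Qed.

End AbsvalTheory.

Record mseries (m : nat) (F : Type) := MSeries {
  mscoef :> 'X_{1..m} -> F
}.

Section MSeriesRing.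
Variables (m : nat) (F : fieldType).
Implicit Types f g h : mseries m F.

Lemma mseriesP f g : (forall a, f a = g a) -> f = g.
Proof. by case: f g => f [g] /= fg; congr MSeries; apply/funext. Qed.

HB.instance Definition _ := gen_eqMixin (mseries m F).
HB.instance Definition _ := gen_choiceMixin (mseries m F).

Definition ms_zero : mseries m F := MSeries (fun=> 0).
Definition ms_opp f : mseries m F := MSeries (fun a => - f a).
Definition ms_add f g : mseries m F := MSeries (fun a => f a + g a).
Definition ms_const (c : F) : mseries m F :=
  MSeries (fun a => c *+ (a == 0%MM)).
Definition ms_mul f g : mseries m F :=
  MSeries (fun a =>
    \sum_(k : 'X_{1..m < (mdeg a).+1, (mdeg a).+1} | a == (k.1 + k.2)%MM)
      f k.1 * g k.2).

Fact ms_addA : associative ms_add.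
Proof. by move=> f g h; apply: mseriesP => a /=; rewrite addrA. Qed.
Fact ms_addC : commutative ms_add.
Proof. by move=> f g; apply: mseriesP => a /=; rewrite addrC. Qed.
Fact ms_add0 : left_id ms_zero ms_add.
Proof. by move=> f; apply: mseriesP => a /=; rewrite add0r. Qed.
Fact ms_addN : left_inverse ms_zero ms_opp ms_add.
Proof. by move=> f; apply: mseriesP => a /=; rewrite addNr. Qed.

HB.instance Definition _ := GRing.isZmodule.Build (mseries m F)
  ms_addA ms_addC ms_add0 ms_addN.

Definition ms_trunc (d : nat) f : {mpoly F[m]} :=
  \sum_(a : 'X_{1..m < d}) f a *: 'X_[a].

Lemma coef_ms_trunc d f a : (mdeg a < d)%N -> (ms_trunc d f)@_a = f a.
Proof. exact: mcoeff_mpoly. Qed.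

Lemma ms_mul_coef f g (p q : {mpoly F[m]}) a :
    (forall b, (mdeg b <= mdeg a)%N -> p@_b = f b) ->
    (forall b, (mdeg b <= mdeg a)%N -> q@_b = g b) ->
  ms_mul f g a = (p * q)@_a.
Proof.
move=> pf qg; rewrite mcoeffM /=; apply: eq_bigr => k _.
by rewrite pf ?qg // -ltnS bmdeg.
Qed.

Lemma ms_trunc_le d f b : (mdeg b <= d)%N -> (ms_trunc d.+1 f)@_b = f b.
Proof. by move=> bd; rewrite coef_ms_trunc. Qed.

Lemma ms_mul_trunc d f g b : (mdeg b <= d)%N ->
  (ms_trunc d.+1 f * ms_trunc d.+1 g)@_b = ms_mul f g b.
Proof.
move=> bd; symmetry; apply: ms_mul_coef => c cb;
  by rewrite ms_trunc_le // (leq_trans cb).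
Qed.

Fact ms_mulC : commutative ms_mul.
Proof.
move=> f g; apply: mseriesP => a.
by rewrite -!(ms_mul_trunc _ _ (leqnn _)) mulrC.
Qed.

Fact ms_mulA : associative ms_mul.
Proof.
move=> f g h; apply: mseriesP => a; pose t := ms_trunc (mdeg a).+1.
rewrite (@ms_mul_coef f _ (t f) (t g * t h)); first last.
- by move=> b ba; rewrite ms_mul_trunc.
- by move=> b ba; rewrite ms_trunc_le.
rewrite (@ms_mul_coef _ h (t f * t g) (t h)) ?mulrA // => b ba.
- by rewrite ms_mul_trunc.
- by rewrite ms_trunc_le.
Qed.

Fact ms_mul1 : left_id (ms_const 1) ms_mul.
Proof.
move=> f; apply: mseriesP => a; pose t := ms_trunc (mdeg a).+1.
rewrite (@ms_mul_coef _ f 1 (t f)) ?mul1r ?ms_trunc_le // => b ba.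
- by rewrite mcoeff1 /=; case: eqP.
- by rewrite ms_trunc_le.
Qed.

Fact ms_mulDl : left_distributive ms_mul ms_add.
Proof.
move=> f g h; apply: mseriesP => a /=; rewrite -big_split /=.
by apply: eq_bigr => k _; rewrite mulrDl.
Qed.

Fact ms_one_neq0 : ms_const 1 != ms_zero.
Proof.
apply/eqP => /(congr1 (fun f : mseries m F => f 0%MM)) /= /eqP.
by rewrite eqxx oner_eq0.
Qed.

HB.instance Definition _ := GRing.Zmodule_isComNzRing.Build (mseries m F)
  ms_mulA ms_mulC ms_mul1 ms_mulDl ms_one_neq0.

Lemma mscoef0 a : (0 : mseries m F) a = 0. Proof. by []. Qed.
Lemma mscoef1 a : (1 : mseries m F) a = (a == 0%MM)%:R. Proof. by []. Qed.
Lemma mscoefN f a : (- f) a = - f a. Proof. by []. Qed.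
Lemma mscoefD f g a : (f + g) a = f a + g a. Proof. by []. Qed.
Lemma mscoefM f g a : (f * g) a =
  \sum_(k : 'X_{1..m < (mdeg a).+1, (mdeg a).+1} | a == (k.1 + k.2)%MM)
    f k.1 * g k.2.
Proof. by []. Qed.

End MSeriesRing.

(* Over a non-Archimedean field, a series converges if and only if its terms
   tend to 0, so [ms_cvg_on v r f] is convergence on the closed polydisc of
   radius [r]: |a_k| r^|k| -> 0 as |k| -> oo. *)
Definition ms_cvg_on (R : realType) (F : fieldType) (v : nonarch_absval R F)
    (m : nat) (r : R) (f : mseries m F) : Prop :=
  forall e : R, 0 < e -> exists N : nat, forall k : 'X_{1..m},
    (N <= mdeg k)%N -> v (f k) * r ^+ mdeg k < e.

Definition entire (R : realType) (F : fieldType) (v : nonarch_absval R F)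
    (m : nat) : {pred mseries m F} :=
  fun f => `[< forall r : R, 0 < r -> ms_cvg_on v r f >].
Arguments entire {R F} v m.

Section Entire.
Variables (R : realType) (F : fieldType) (v : nonarch_absval R F) (m : nat).
Implicit Types f g : mseries m F.

Lemma entireP f :
  reflect (forall r : R, 0 < r -> ms_cvg_on v r f) (f \in entire v m).
Proof. exact: asboolP. Qed.

Lemma ms_cvg_bounded (r : R) f : 0 < r -> ms_cvg_on v r f ->
  exists2 M : R, 0 < M & forall k, v (f k) * r ^+ mdeg k <= M.
Proof.
move=> r0 /(_ 1 ltr01)[N fN].
have t0 k : 0 <= v (f k) * r ^+ mdeg k.
  by rewrite mulr_ge0 ?absval_ge0 ?exprn_ge0 ?ltW.
exists (1 + \sum_(k : 'X_{1..m < N}) v (f k) * r ^+ mdeg k).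
  by rewrite ltr_wpDr // sumr_ge0.
move=> k; have [Nk|kN] := leqP N (mdeg k).
  by apply: ler_wpDr; rewrite ?sumr_ge0 // ltW // fN.
apply: ler_wpDl; rewrite ?ler01 // (bigD1 (BMultinom kN)) //=.
by rewrite ler_wpDr // sumr_ge0.
Qed.

Fact entire_subring : subring_closed (entire v m).
Proof.
split.
- apply/entireP => r r0 e e0; exists 1%N => k k0.
  rewrite mscoef1 (_ : (k == 0%MM) = false) ?absval0 ?mul0r //.
  by apply/eqP => k00; move: k0; rewrite k00 mdeg0.
- move=> f g /entireP fe /entireP ge; apply/entireP => r r0 e e0.
  have [N fN] := fe r r0 e e0; have [N' gN] := ge r r0 e e0.
  exists (maxn N N') => k; rewrite geq_max => /andP[Nk N'k].
  have re : 0 < r ^+ mdeg k by rewrite exprn_gt0.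
  rewrite -ltr_pdivlMr //; apply: le_lt_trans (absvalD_max v _ _) _.
  by rewrite absvalN gt_max !ltr_pdivlMr // fN // gN.
- move=> f g /entireP fe /entireP ge; apply/entireP => r r0 e e0.
  have [A A0 fA] := ms_cvg_bounded r0 (fe r r0).
  have [B B0 gB] := ms_cvg_bounded r0 (ge r r0).
  have [N fN] := fe r r0 (e / B) (divr_gt0 e0 B0).
  have [N' gN] := ge r r0 (e / A) (divr_gt0 e0 A0).
  exists (N + N')%N => k Nk.
  have re : 0 < r ^+ mdeg k by rewrite exprn_gt0.
  rewrite -ltr_pdivlMr // mscoefM; apply: absval_sum_lt; first exact: divr_gt0.
  move=> [[a ak] [b bk]] /= /eqP kE {ak bk}; rewrite ltr_pdivlMr //.
  move: Nk; rewrite kE mdegD exprD absvalM => Nk; rewrite mulrACA.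
  have t0 h (c : 'X_{1..m}) : 0 <= v (h c) * r ^+ mdeg c.
    by rewrite mulr_ge0 ?absval_ge0 ?exprn_ge0 ?ltW.
  have [Na|aN] := leqP N (mdeg a).
    apply: le_lt_trans (_ : _ <= v (f a) * r ^+ mdeg a * B) _.
      by rewrite ler_wpM2l.
    by rewrite -ltr_pdivlMr // fN.
  apply: le_lt_trans (_ : _ <= A * (v (g b) * r ^+ mdeg b)) _.
    by rewrite ler_wpM2r.
  rewrite mulrC -ltr_pdivlMr // gN //.
  by rewrite -(leq_add2l N) (leq_trans Nk) // leq_add2r ltnW.
Qed.

HB.instance Definition _ :=
  GRing.isSubringClosed.Build (mseries m F) (entire v m) entire_subring.

Record entire_fun := EntireFun {
  ef_series :> mseries m F;
  ef_entire : ef_series \in entire v m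
}.

HB.instance Definition _ := [isSub for ef_series].
HB.instance Definition _ := [Choice of entire_fun by <:].
HB.instance Definition _ := [SubChoice_isSubComNzRing of entire_fun by <:].

Definition ef_unit : {pred entire_fun} :=
  fun f : entire_fun => `[< exists g : entire_fun, g * f = 1 >].

Definition ef_inv (f : entire_fun) : entire_fun :=
  if pselect (exists g : entire_fun, g * f = 1) is left h then projT1 (cid h) else f.

Fact ef_mulVx : {in ef_unit, left_inverse 1 ef_inv *%R}.
Proof.
move=> f /asboolP fu; rewrite /ef_inv.
by case: pselect => // h; case: (cid h).
Qed.

Fact ef_unitPl (f g : entire_fun) : g * f = 1 -> ef_unit f.
Proof. by move=> gf; apply/asboolP; exists g. Qed.

Fact ef_inv_out : {in [predC ef_unit], ef_inv =1 id}.
Proof.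
move=> f; rewrite inE /= => /asboolPn fu; rewrite /ef_inv.
by case: pselect.
Qed.

HB.instance Definition _ := GRing.ComNzRing_hasMulInverse.Build entire_fun
  ef_mulVx ef_unitPl ef_inv_out.

Definition ef_constant (f : entire_fun) : Prop :=
  forall k : 'X_{1..m}, k != 0%MM -> f k = 0.

End Entire.

Definition divides (A : comNzRingType) (a b : A) : Prop :=
  exists c : A, b = c * a.

Definition irreducible_elt (A : comUnitRingType) (p : A) : Prop :=
  p \isn't a GRing.unit /\
  forall g h : A, p = g * h -> g \is a GRing.unit \/ h \is a GRing.unit.

Definition square_free (R : realType) (F : fieldType)
    (v : nonarch_absval R F) (m : nat) (f : entire_fun v m) : Prop :=
  forall g : entire_fun v m, ~ ef_constant g -> ~ divides (g ^+ 2) f.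

(* Main.v *)
(* Let c have |c| > 1. On the polydisc of radius |c|^n the function f becomes, after
   rescaling, an element f_n of the Tate algebra T of power series whose coefficients
   tend to 0, and restriction to the polydisc of radius |c|^(n-1) becomes the
   endomorphism theta : X -> X/c of T. By Weierstrass preparation and Gauss's lemma
   T is factorial, so f_n has a radical s_n and finitely many divisors up to units.

   A sequence of g_n in T such that theta g_(n+1) and g_n are associated comes from
   an entire function: by the Schwarz lemma the units relating them, normalised to
   have constant term 1, have a convergent infinite product. Since the s_n are
   square free, theta^j s_(n+j) increases with j for divisibility among the divisors
   of f_n, hence is eventually constant up to units; gluing the limits gives S.
   A prime whose square divides S on one polydisc becomes a unit on every smaller
   one, so that S is square free. If P is irreducible and divides f, the elements
   theta^j gcd(P_(n+j), S_(n+j)) decrease with j, and gluing their limits gives a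
   nonunit common divisor of P and S, which is therefore associated to P. *)
Require Import Defs.
From HB Require Import structures.
From mathcomp Require Import all_boot all_order all_algebra.
From mathcomp Require Import boolp reals ring zify.
From mathcomp Require Import mpoly.

Set Implicit Arguments.
Unset Strict Implicit.
Unset Printing Implicit Defensive.

Import Order.TTheory GRing.Theory Num.Theory.
Import Pdiv.CommonRing Pdiv.RingMonic.
Local Open Scope ring_scope.

(** * Tate algebras and their Gauss norm *)

(** An entire function can have infinitely many irreducible factors, so the ring of entire functions
    is not factorial in general, and S can be built neither by induction on factors nor as a finite
    product. Only the polydiscs have finite factorizations. The price is that their units are more
    than constants: they have the form a (1 + h) with |h| < 1, so data chosen on different polydiscs
    agree only up to such units, and the gluing has to repair this.

    Moreover, an irreducible P may split on a polydisc, so it need not be prime there.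
    Irreducibility is therefore applied only once, to an entire divisor of P obtained by gluing.

    The radii |c|^n lie in the value group, which lets every polydisc be rescaled to the unit one,
    so that a single algebra T serves for all n. Factoriality of T goes by induction on the number
    of variables: a shear makes the dominant part of a series monic in the last variable, and
    preparation replaces the series by a polynomial over the algebra with one variable less. Chains
    of divisors of f_n stop because the number of prime factors is bounded. *)

Section Ultrametric.
Variables (R : realType) (F : fieldType) (v : nonarch_absval R F).

Lemma absval_sum_le (I : finType) (P : pred I) (E : I -> F) (x : R) :
  0 <= x -> (forall i, P i -> v (E i) <= x) -> v (\sum_(i | P i) E i) <= x.
Proof.
move=> x0 vE; elim/big_ind: _ => //; first by rewrite absval0.
by move=> y z yx zx; apply: le_trans (absvalD_max v y z) _; rewrite ge_max yx.
Qed.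

Lemma absvalD_dom x y : v y < v x -> v (x + y) = v x.
Proof.
move=> yx; apply/eqP; rewrite eq_le; apply/andP; split.
  by apply: le_trans (absvalD_max v x y) _; rewrite ge_max lexx ltW.
have := absvalD_max v (x + y) (- y); rewrite addrK absvalN le_max.
by case/orP => // /(lt_le_trans yx); rewrite ltxx.
Qed.

Lemma absvalB_le x y e : v x <= e -> v y <= e -> v (x - y) <= e.
Proof.
by move=> xe ye; apply: le_trans (absvalD_max v _ _) _; rewrite absvalN ge_max xe.
Qed.

Lemma absval_neq0 x : (v x != 0) = (x != 0).
Proof. by congr negb; apply/eqP/eqP => /(absval_eq0 v). Qed.

Lemma absval_gt0 x : (0 < v x) = (x != 0).
Proof. by rewrite lt_def absval_ge0 andbT absval_neq0. Qed.

Lemma absvalV x : v x^-1 = (v x)^-1.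
Proof.
have [->|x0] := eqVneq x 0; first by rewrite invr0 absval0 invr0.
by apply: (mulfI (_ : v x != 0)); rewrite ?absval_neq0 // -absvalM !divff
  ?absval1 ?absval_neq0.
Qed.

Lemma absvalX x n : v (x ^+ n) = v x ^+ n.
Proof. by elim: n => [|n IH]; rewrite ?absval1 // !exprS absvalM IH. Qed.

End Ultrametric.

Section SeriesMul.
Variables (R : realType) (F : fieldType) (v : nonarch_absval R F) (m : nat).
Implicit Types f g : mseries m F.

Lemma mscoefM_le f g a x : 0 <= x ->
  (forall k l, a = (k + l)%MM -> v (f k) * v (g l) <= x) -> v ((f * g) a) <= x.
Proof.
move=> x0 fgx; rewrite mscoefM; apply: absval_sum_le => // k /eqP ak.
by rewrite absvalM; apply: fgx.
Qed.

Lemma mscoefM_lt f g a x : 0 < x ->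
  (forall k l, a = (k + l)%MM -> v (f k) * v (g l) < x) -> v ((f * g) a) < x.
Proof.
move=> x0 fgx; rewrite mscoefM; apply: absval_sum_lt => // k /eqP ak.
by rewrite absvalM; apply: fgx.
Qed.

(** One term of the convolution strictly dominates all others, so the ultrametric inequality is an
    equality. Multiplicativity of the Gauss norm and the Weierstrass estimate both reduce to this by
    a suitable choice of [k] and [l]. *)
Lemma mscoefM_dom f g k l :
  (forall k' l', (k' + l' = k + l)%MM -> k' != k ->
     v (f k') * v (g l') < v (f k) * v (g l)) ->
  v ((f * g) (k + l)%MM) = v (f k) * v (g l).
Proof.
move=> fgx; rewrite mscoefM.
have kd : (mdeg k < (mdeg (k + l)).+1)%N by rewrite mdegD ltnS leq_addr.
have ld : (mdeg l < (mdeg (k + l)).+1)%N by rewrite mdegD ltnS leq_addl.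
rewrite (bigD1 (BMultinom kd, BMultinom ld)) //= -absvalM.
have H (i : 'X_{1..m < (mdeg (k + l)).+1, (mdeg (k + l)).+1}) :
    (k + l == i.1 + i.2)%MM && (i != (BMultinom kd, BMultinom ld)) ->
    v (f i.1 * g i.2) < v (f k * g l).
  case: i => k' l' /andP[/eqP /= e ne]; rewrite !absvalM; apply: fgx => //.
  apply: contra ne => /eqP kk; move: e; rewrite kk => /addmI ll.
  by apply/eqP; congr pair; apply: val_inj.
(* If the distinguished term vanishes, the strict bounds leave no other term in the sum. *)
have [x0|] := eqVneq (f k * g l) 0.
  rewrite big1 ?addr0 // => i iP; have := H i iP; rewrite x0 absval0 => h.
  by have := absval_ge0 v (f i.1 * g i.2); rewrite leNgt h.
rewrite -(absval_gt0 v) => x0; rewrite absvalD_dom //.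
exact: absval_sum_lt.
Qed.

End SeriesMul.

Section Tate.
Variables (R : realType) (F : fieldType) (v : nonarch_absval R F) (m : nat).
Implicit Types f g : mseries m F.

Definition tate_pred : {pred mseries m F} := fun f =>
  `[< forall e : R, 0 < e -> exists N, forall k,
      (N <= mdeg k)%N -> v (f k) < e >].

Lemma tate_predP f : reflect (forall e : R, 0 < e -> exists N, forall k,
      (N <= mdeg k)%N -> v (f k) < e) (f \in tate_pred).
Proof. exact: asboolP. Qed.

(** Only finitely many coefficients are at least as large as a given nonzero one. Hence the Gauss
    norm is a maximum and can be defined as the size of one coefficient. *)
Lemma tate_attained f : f \in tate_pred ->
  exists k, forall l, v (f l) <= v (f k).
Proof.
move=> /tate_predP fT.
have [f0|/existsNP[k1 /eqP fk1]] := pselect (forall k, f k = 0).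
  by exists 0%MM => l; rewrite !f0.
have [|N fN] := fT (v (f k1)); first by rewrite absval_gt0.
have k1N : (mdeg k1 < N)%N.
  by rewrite ltnNge; apply/negP => /fN; rewrite ltxx.
pose i0 := BMultinom k1N.
case: (@Order.TotalTheory.arg_maxP _ R 'X_{1..m < N} i0 predT
  (fun i => v (f i))) => //= i _ iM.
exists i => l; have [lN|Nl] := ltnP (mdeg l) N.
  exact: (iM (BMultinom lN)).
by apply: le_trans (iM i0 isT); apply/ltW/fN.
Qed.

Fact tate_subring : subring_closed tate_pred.
Proof.
split.
- apply/tate_predP => e e0; exists 1%N => k k0.
  rewrite mscoef1 -mdeg_eq0; by case: (mdeg k) k0 => //= *; rewrite absval0.
- move=> f g /tate_predP fT /tate_predP gT; apply/tate_predP => e e0.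
  have [N fN] := fT e e0; have [N' gN] := gT e e0.
  exists (maxn N N') => k; rewrite geq_max => /andP[Nk N'k].
  apply: le_lt_trans (absvalD_max v _ _) _.
  by rewrite absvalN gt_max fN // gN.
- move=> f g fT gT; apply/tate_predP => e e0.
  have [kf fM] := tate_attained fT; have [kg gM] := tate_attained gT.
  have [A A0 fA] : exists2 A, 0 < A & forall k, v (f k) <= A.
    by exists (1 + v (f kf)) => [|k]; rewrite ?ltr_wpDr ?absval_ge0 //
      ler_wpDl.
  have [B B0 gB] : exists2 B, 0 < B & forall k, v (g k) <= B.
    by exists (1 + v (g kg)) => [|k]; rewrite ?ltr_wpDr ?absval_ge0 //
      ler_wpDl.
  move/tate_predP: fT => fT; move/tate_predP: gT => gT.
  have [N fN] := fT (e / B) (divr_gt0 e0 B0).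
  have [N' gN] := gT (e / A) (divr_gt0 e0 A0).
  exists (N + N')%N => k Nk; apply: mscoefM_lt => // a b kE.
  have [Na|aN] := leqP N (mdeg a).
    apply: le_lt_trans (_ : _ <= v (f a) * B) _.
      by rewrite ler_wpM2l ?absval_ge0.
    by rewrite -ltr_pdivlMr // fN.
  apply: le_lt_trans (_ : _ <= A * v (g b)) _.
    by rewrite ler_wpM2r ?absval_ge0.
  rewrite mulrC -ltr_pdivlMr // gN //; move: Nk; rewrite kE mdegD => Nk.
  by rewrite -(leq_add2l N) (leq_trans Nk) // leq_add2r ltnW.
Qed.

HB.instance Definition _ :=
  GRing.isSubringClosed.Build (mseries m F) tate_pred tate_subring.

Record tate := Tate { tate_series :> mseries m F; tateP : tate_series \in tate_pred }.

HB.instance Definition _ := [isSub for tate_series].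
HB.instance Definition _ := [Choice of tate by <:].
HB.instance Definition _ := [SubChoice_isSubComNzRing of tate by <:].

Definition tate_unit : {pred tate} :=
  fun f : tate => `[< exists g : tate, g * f = 1 >].

Definition tate_inv (f : tate) : tate :=
  if pselect (exists g : tate, g * f = 1) is left h then projT1 (cid h) else f.

Fact tate_mulVx : {in tate_unit, left_inverse 1 tate_inv *%R}.
Proof.
move=> f /asboolP fu; rewrite /tate_inv.
by case: pselect => // h; case: (cid h).
Qed.

Fact tate_unitPl (f g : tate) : g * f = 1 -> tate_unit f.
Proof. by move=> gf; apply/asboolP; exists g. Qed.

Fact tate_inv_out : {in [predC tate_unit], tate_inv =1 id}.
Proof.
move=> f; rewrite inE /= => /asboolPn fu; rewrite /tate_inv.
by case: pselect.
Qed.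

HB.instance Definition _ := GRing.ComNzRing_hasMulInverse.Build tate
  tate_mulVx tate_unitPl tate_inv_out.

Lemma tate_eqP (f g : tate) : (forall k, f k = g k) -> f = g.
Proof. by move=> fg; apply/val_inj/mseriesP. Qed.

Lemma tcoefD (f g : tate) k : (f + g) k = f k + g k. Proof. by []. Qed.
Lemma tcoefN (f : tate) k : (- f) k = - f k. Proof. by []. Qed.
Lemma tcoefB (f g : tate) k : (f - g) k = f k - g k. Proof. by []. Qed.
Lemma tcoef0 k : (0 : tate) k = 0. Proof. by []. Qed.
Lemma tcoef1 k : (1 : tate) k = (k == 0%MM)%:R. Proof. by []. Qed.

Definition tnorm (f : tate) : R := v (f (projT1 (cid (tate_attained (tateP f))))).

Lemma tnorm_ub (f : tate) k : v (f k) <= tnorm f.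
Proof. exact: (projT2 (cid (tate_attained (tateP f)))). Qed.

Lemma tnorm_attained (f : tate) : exists k, tnorm f = v (f k).
Proof. by exists (projT1 (cid (tate_attained (tateP f)))). Qed.

Lemma tnorm_le (f : tate) x : (forall k, v (f k) <= x) -> tnorm f <= x.
Proof. by have [k ->] := tnorm_attained f. Qed.

Lemma tnorm_lt (f : tate) x : (forall k, v (f k) < x) -> tnorm f < x.
Proof. by have [k ->] := tnorm_attained f. Qed.

Lemma tnorm_ge0 (f : tate) : 0 <= tnorm f.
Proof. exact: absval_ge0. Qed.

Lemma tnorm0 : tnorm 0 = 0.
Proof. by have [k ->] := tnorm_attained 0; rewrite tcoef0 absval0. Qed.

Lemma tnorm_eq0 (f : tate) : (tnorm f == 0) = (f == 0).
Proof.
apply/eqP/eqP => [f0|->]; last exact: tnorm0.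
apply: tate_eqP => k; apply/(absval_eq0 v)/eqP.
by rewrite eq_le absval_ge0 andbT -f0 tnorm_ub.
Qed.

Lemma tnorm_gt0 (f : tate) : (0 < tnorm f) = (f != 0).
Proof. by rewrite lt_def tnorm_ge0 andbT tnorm_eq0. Qed.

Lemma tnormN (f : tate) : tnorm (- f) = tnorm f.
Proof.
apply/eqP; rewrite eq_le !tnorm_le // => k; rewrite ?tcoefN ?absvalN ?tnorm_ub //.
by rewrite -absvalN -tcoefN tnorm_ub.
Qed.

Lemma tnormD_le (f g : tate) x : tnorm f <= x -> tnorm g <= x -> tnorm (f + g) <= x.
Proof.
move=> fx gx; apply: tnorm_le => k; apply: le_trans (absvalD_max v _ _) _.
by rewrite ge_max (le_trans (tnorm_ub f k)) // (le_trans (tnorm_ub g k)).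
Qed.

Lemma tnormB_le (f g : tate) x : tnorm f <= x -> tnorm g <= x -> tnorm (f - g) <= x.
Proof. by move=> fx gx; apply: tnormD_le; rewrite ?tnormN. Qed.

Lemma tnorm1 : tnorm 1 = 1.
Proof.
apply/eqP; rewrite eq_le; apply/andP; split; last first.
  by rewrite -(absval1 v); have := tnorm_ub 1 0%MM; rewrite tcoef1 eqxx.
apply: tnorm_le => k; rewrite tcoef1.
by case: eqP; rewrite ?absval1 ?absval0 ?ler01.
Qed.

(** The norm is attained at finitely many exponents, so one of them has maximal [key]. The key is
    the monomial order for products and units, and the last exponent for Weierstrass division. *)
Lemma tate_leading_by d (K : orderType d) (key : 'X_{1..m} -> K) (f : tate) :
  f != 0 -> exists k, tnorm f = v (f k) /\
    forall l, (key k < key l)%O -> v (f l) < tnorm f.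
Proof.
move=> f0; have /tate_predP/(_ (tnorm f)) := tateP f.
rewrite tnorm_gt0 => /(_ f0)[N fN]; have [k0 fk0] := tnorm_attained f.
have k0N : (mdeg k0 < N)%N.
  by rewrite ltnNge; apply/negP => /fN; rewrite fk0 ltxx.
pose i0 := BMultinom k0N.
case: (@Order.TotalTheory.arg_maxP _ K 'X_{1..m < N} i0
  (fun i => tnorm f == v (f i)) (fun i => key i)) => /= [|i /eqP fi iM].
  exact/eqP.
exists i; split => // l il; rewrite lt_neqAle tnorm_ub andbT.
apply/negP => /eqP fl; have lN : (mdeg l < N)%N.
  by rewrite ltnNge; apply/negP => /fN; rewrite fl ltxx.
by have := iM (BMultinom lN); rewrite /= fl eqxx leNgt il => /(_ isT).
Qed.

Lemma tate_leading (f : tate) : f != 0 -> exists k, tnorm f = v (f k) /\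
  forall l, (k < l)%O -> v (f l) < tnorm f.
Proof. exact: (@tate_leading_by _ _ id). Qed.

(** The monomial order is compatible with addition: in any other splitting of [k + l] one exponent
    exceeds [k] or [l], where the coefficients are strictly below the norm. *)
Lemma tate_lead_mul (f g : tate) k l :
  tnorm f = v (f k) -> (forall l, (k < l)%O -> v (f l) < tnorm f) ->
  tnorm g = v (g l) -> (forall k, (l < k)%O -> v (g k) < tnorm g) ->
  f != 0 -> g != 0 ->
  v ((f * g) (k + l)%MM) = tnorm f * tnorm g.
Proof.
move=> fk kM gl lM; rewrite -!tnorm_gt0 => f0 g0.
have vf i : 0 <= v i by exact: absval_ge0.
rewrite fk gl -[LHS]/(v ((tate_series f * tate_series g) _)).
apply: mscoefM_dom => k' l' e; rewrite -fk -gl neq_lt => /orP[k'k|kk'].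
- have l'l : (l < l')%O.
    rewrite ltNge; apply/negP => l'l.
    by have := ltmc_le_add k'k l'l; rewrite e ltxx.
  apply: le_lt_trans (_ : tnorm f * v (g l') < _).
    by rewrite ler_wpM2r ?tnorm_ub.
  by rewrite ltr_pM2l // lM.
- apply: le_lt_trans (_ : v (f k') * tnorm g < _).
    by rewrite ler_wpM2l ?tnorm_ub.
  by rewrite ltr_pM2r // kM.
Qed.

Lemma tnormM (f g : tate) : tnorm (f * g) = tnorm f * tnorm g.
Proof.
have [->|f0] := eqVneq f 0; first by rewrite mul0r tnorm0 mul0r.
have [->|g0] := eqVneq g 0; first by rewrite mulr0 tnorm0 mulr0.
apply/eqP; rewrite eq_le; apply/andP; split.
  apply: tnorm_le => a; apply: mscoefM_le => [|k l _].
    by rewrite mulr_ge0 ?tnorm_ge0.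
  by apply: ler_pM; rewrite ?absval_ge0 ?tnorm_ub.
have [k [fk kM]] := tate_leading f0; have [l [gl lM]] := tate_leading g0.
by rewrite -(tate_lead_mul fk kM gl lM f0 g0) tnorm_ub.
Qed.

Fact tate_integral : GRing.integral_domain_axiom tate.
Proof.
move=> f g /(congr1 tnorm)/eqP; rewrite tnormM tnorm0 mulf_eq0 !tnorm_eq0.
by [].
Qed.

HB.instance Definition _ := GRing.ComUnitRing_isIntegral.Build tate tate_integral.

End Tate.

Section Geometric.
Variable R : realType.

Lemma geometric_lt (x C e : R) : 0 <= x < 1 -> 0 < e -> exists n, C * x ^+ n < e.
Proof.
move=> /andP[x0 x1] e0.
have [->|xn0] := eqVneq x 0; first by exists 1%N; rewrite expr1 mulr0.
have xp : 0 < x by rewrite lt_def xn0.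
pose d := x^-1 - 1; have d0 : 0 < d by rewrite subr_gt0 invf_gt1.
(* Bernoulli's inequality, which reduces the claim to the Archimedean property. *)
have B n : 1 + d *+ n <= x^-1 ^+ n.
  have -> : x^-1 = 1 + d by rewrite addrC subrK.
  elim: n => [|n IH]; first by rewrite mulr0n addr0.
  rewrite exprSr mulrDr mulr1 mulrSr addrA lerD // ler_peMl ?(ltW d0) //.
  by rewrite (le_trans _ IH) // lerDl mulrn_wge0 // ltW.
pose n := Num.bound (`|C| / (e * d)); exists n.
have nP : `|C| / (e * d) < n%:R.
  by apply: archi_boundP; apply: divr_ge0 => //; apply: mulr_ge0; apply: ltW.
rewrite -ltr_pdivlMr ?exprn_gt0 // -exprVn.
apply: lt_le_trans (_ : _ < e * (d *+ n)) _.
  apply: le_lt_trans (ler_norm _) _.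
  by rewrite mulrnAr -mulr_natl -ltr_pdivrMr // mulr_gt0.
by rewrite ler_wpM2l ?(ltW e0) // (le_trans _ (B n)) // ler_wpDl.
Qed.

Lemma geometric_le0 (x C y : R) : 0 <= x < 1 -> (forall n, y <= C * x ^+ n) -> y <= 0.
Proof.
move=> x01 yx; rewrite leNgt; apply/negP => /(geometric_lt C x01)[n].
by rewrite ltNge yx.
Qed.

End Geometric.

(** * Completeness of the Tate algebra and its units *)

Section TateComplete.
Variables (R : realType) (F : fieldType) (v : nonarch_absval R F) (m : nat).
Local Notation T := (tate v m).

Lemma mscoefCM (c : F) (f : mseries m F) k : (ms_const m c * f) k = c * f k.
Proof.
rewrite -[LHS]/(ms_mul (ms_const m c) f k).
rewrite (@ms_mul_coef _ _ _ _ c%:MP (ms_trunc (mdeg k).+1 f)).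
- by rewrite mcoeffCM ms_trunc_le.
- by move=> b _; rewrite mcoeffC mulr_natr.
- by move=> b; apply: ms_trunc_le.
Qed.

Fact tconst_subproof (c : F) : ms_const m c \in @tate_pred R F v m.
Proof.
apply/tate_predP => e e0; exists 1%N => k k0 /=.
by rewrite -mdeg_eq0; case: (mdeg k) k0 => //= *; rewrite absval0.
Qed.

Definition tconst (c : F) : T := Tate (tconst_subproof c).

Lemma tcoefC c k : tconst c k = c *+ (k == 0%MM). Proof. by []. Qed.

Lemma tcoefCM c (f : T) k : (tconst c * f) k = c * f k.
Proof. exact: mscoefCM. Qed.

Fact tconst_zmod : zmod_morphism tconst.
Proof. by move=> a b; apply: tate_eqP => k; rewrite tcoefB !tcoefC mulrnBl. Qed.

Fact tconst_monoid : monoid_morphism tconst.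
Proof.
split=> [|a b]; apply: tate_eqP => k //.
by rewrite tcoefCM !tcoefC mulrnAr.
Qed.

HB.instance Definition _ := GRing.isZmodMorphism.Build F T tconst tconst_zmod.
HB.instance Definition _ := GRing.isMonoidMorphism.Build F T tconst tconst_monoid.

Lemma tconst1 : tconst 1 = 1. Proof. exact: rmorph1. Qed.
Lemma tconstM a b : tconst (a * b) = tconst a * tconst b. Proof. exact: rmorphM. Qed.

Lemma tconst_unit c : c != 0 -> tconst c \is a GRing.unit.
Proof. by move=> c0; rewrite rmorph_unit // unitfE. Qed.

Lemma tnormC c : tnorm (tconst c) = v c.
Proof.
apply/eqP; rewrite eq_le; apply/andP; split; last first.
  by have := tnorm_ub (tconst c) 0%MM; rewrite tcoefC eqxx.
apply: tnorm_le => k; rewrite tcoefC.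
by case: eqP; rewrite ?absval0 ?absval_ge0.
Qed.

Hypothesis v_complete : absval_complete v.

(** By the ultrametric inequality the bound on one step also bounds all later differences, and so
    survives in the limit with the same constants. *)
Lemma tate_complete (u : nat -> T) (C x : R) : 0 <= x < 1 -> 0 <= C ->
    (forall n, tnorm (u n.+1 - u n) <= C * x ^+ n) ->
  exists s : T, forall n, tnorm (s - u n) <= C * x ^+ n.
Proof.
move=> /[dup] x01 /andP[x0 x1] C0 uC.
have uC' i n : tnorm (u (n + i)%N - u n) <= C * x ^+ n.
  elim: i => [|i IH]; first by rewrite addn0 subrr tnorm0 mulr_ge0 ?exprn_ge0.
  rewrite -[u (n + i.+1)%N](subrK (u (n + i)%N)) -addrA tnormD_le // addnS.
  rewrite (le_trans (uC _)) // ler_wpM2l // exprD ler_piMr ?exprn_ge0 //.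
  by rewrite exprn_ile1 // ltW.
have uC2 i n k : (n <= i)%N -> v (u i k - u n k) <= C * x ^+ n.
  by move=> /subnKC <-; rewrite -tcoefB; apply: le_trans (tnorm_ub _ _) (uC' _ _).
have lP k : exists l, absval_cvg v (fun n => u n k) l.
  apply: v_complete => e e0; have [N NC] := geometric_lt C x01 e0.
  exists N => i j iN jN; apply: le_lt_trans NC.
  have -> : u i k - u j k = (u i k - u N k) - (u j k - u N k).
    by rewrite opprB addrA subrK.
  by apply: absvalB_le; apply: uC2.
pose l k := projT1 (cid (lP k)).
have lu k n : v (l k - u n k) <= C * x ^+ n.
  rewrite leNgt; apply/negP => lt.
  have [|N NP] := projT2 (cid (lP k)) (v (l k - u n k)).
    by apply: le_lt_trans lt; rewrite mulr_ge0 ?exprn_ge0.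
  have := NP (maxn N n) (leq_maxl _ _); rewrite -/(l k) => h.
  have : v (l k - u n k) < v (l k - u n k); last by rewrite ltxx.
  have {1}-> : l k - u n k = (l k - u (maxn N n) k) + (u (maxn N n) k - u n k).
    by rewrite addrA subrK.
  apply: le_lt_trans (absvalD_max v _ _) _; rewrite gt_max -absvalN opprB h /=.
  by apply: le_lt_trans lt; rewrite uC2 // leq_maxr.
(* The coefficientwise limit is uniformly close to some [u n], whose coefficients tend to 0. *)
have lT : MSeries l \in @tate_pred R F v m.
  apply/tate_predP => e e0; have [n nC] := geometric_lt C x01 e0.
  have /tate_predP/(_ e e0)[N NP] := tateP (u n).
  exists N => k kN /=; rewrite -[l k](subrK (u n k)).
  apply: le_lt_trans (absvalD_max v _ _) _; rewrite gt_max NP // andbT.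
  exact: le_lt_trans nC.
by exists (Tate lT) => n; apply: tnorm_le => k; apply: lu.
Qed.

Lemma tnorm_lim_eq0 (f : T) (C x : R) : 0 <= x < 1 ->
  (forall n, tnorm f <= C * x ^+ n) -> f = 0.
Proof.
move=> x01 /(geometric_le0 x01) f0; apply/eqP.
by rewrite -tnorm_eq0 eq_le f0 tnorm_ge0.
Qed.

Lemma tnormX (f : T) n : tnorm (f ^+ n) = tnorm f ^+ n.
Proof. by elim: n => [|n IH]; rewrite ?tnorm1 // !exprS tnormM IH. Qed.

Lemma tnorm_1D (h : T) : tnorm h < 1 -> tnorm (1 + h) = 1.
Proof.
move=> h1; apply/eqP; rewrite eq_le; apply/andP; split.
  by apply: tnormD_le; rewrite ?tnorm1 // ltW.
rewrite leNgt; apply/negP => lt.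
have : tnorm (1 : T) < 1; last by rewrite tnorm1 ltxx.
rewrite -[X in tnorm X](addrK h) ; apply: le_lt_trans (_ : Num.max (tnorm (1 + h)) (tnorm h) < _).
  by apply: tnormB_le; rewrite le_max lexx ?orbT.
by rewrite gt_max lt.
Qed.

(** The inverse is the Neumann series of powers of [- h]. *)
Lemma unit_1D (h : T) : tnorm h < 1 -> 1 + h \is a GRing.unit.
Proof.
move=> h1; pose x := tnorm h; have x01 : 0 <= x < 1 by rewrite tnorm_ge0.
pose u n := \sum_(i < n) (- h) ^+ i.
have [|n|s sP] := @tate_complete u 1 x x01; first exact: ler01.
  by rewrite mul1r /u big_ord_recr /= addrAC subrr add0r tnormX tnormN.
apply/unitrP; suff sE : (1 + h) * s = 1 by exists s; rewrite mulrC.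
apply/eqP; rewrite -subr_eq0; apply/eqP/(@tnorm_lim_eq0 _ 1 x) => // n.
have -> : (1 + h) * s - 1 = (1 + h) * (s - u n) - (- h) ^+ n.
  have E : (1 + h) * u n = 1 - (- h) ^+ n.
    by rewrite -[1 - _]opprB subrX1 -/(u n) -mulNr opprB opprK.
  by rewrite mulrBr E opprB addrA addrAC addrK.
by rewrite tnormB_le // ?tnormX ?tnormN ?mul1r // tnormM tnorm_1D // mul1r -[leRHS]mul1r.
Qed.

(** The leading exponents of [u] and [u^-1] add up to an exponent at which 1 has a nonzero
    coefficient, so both are 0. As the leading exponent is the largest one attaining the norm, the
    constant term of [u] strictly dominates all other coefficients. *)
Lemma tate_unitE (u : T) : u \is a GRing.unit ->
  exists (c : F) (h : T), [/\ c != 0, h 0%MM = 0, tnorm h < 1 & u = tconst c * (1 + h)].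
Proof.
move=> uU; have w0 : u^-1 != 0 by rewrite invr_eq0; apply: contraTneq uU => ->; rewrite unitr0.
have u0 : u != 0 by apply: contraTneq uU => ->; rewrite unitr0.
have [k [uk kM]] := tate_leading u0; have [l [wl lM]] := tate_leading w0.
have := tate_lead_mul uk kM wl lM u0 w0.
rewrite mulrV // tcoef1; case: eqP; last first.
  move=> _ /esym/eqP; rewrite absval0 mulf_eq0 !tnorm_eq0.
  by rewrite (negPf u0) (negPf w0).
move=> /eqP; rewrite mnmD_eq0 => /andP[/eqP k0 _] _; subst k.
have c0 : u 0%MM != 0 by rewrite -(absval_gt0 v) -uk tnorm_gt0.
have vc : 0 < v (u 0%MM) by rewrite absval_gt0.
exists (u 0%MM), (tconst (u 0%MM)^-1 * u - 1); split=> //.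
- by rewrite tcoefB tcoefCM tcoef1 eqxx mulVf ?subrr.
- apply: tnorm_lt => j; rewrite tcoefB tcoefCM tcoef1.
  have [->|j0] := eqVneq j 0%MM; first by rewrite mulVf // subrr absval0.
  rewrite subr0 absvalM absvalV mulrC ltr_pdivrMr // mul1r -uk.
  by apply: kM; rewrite lt_def j0 le0m.
- by rewrite addrC subrK mulrA -rmorphM divff // rmorph1 mul1r.
Qed.

End TateComplete.

(** * Substitutions *)

Lemma coef_ms_truncE m (F : fieldType) d (f : mseries m F) a :
  (ms_trunc d f)@_a = if (mdeg a < d)%N then f a else 0.
Proof.
have [ad|da] := ltnP; first exact: coef_ms_trunc.
rewrite /ms_trunc raddf_sum big1 //= => b _; rewrite mcoeffZ mcoeffX.
by case: eqP => [e|]; rewrite ?mulr0 //; have := bmdeg b; rewrite e ltnNge da.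
Qed.

(* A substitution which does not lower the order of a polynomial acts on formal
   power series; if moreover its images of monomials have Gauss norm at most 1,
   it acts on the Tate algebras without increasing the norm. *)
Record substitution (R : realType) (F : fieldType) (v : nonarch_absval R F) n m :=
  Substitution {
    subst_poly :> {rmorphism {mpoly F[n]} -> {mpoly F[m]}};
    subst_polyZ : forall c p, subst_poly (c *: p) = c *: subst_poly p;
    subst_ord : forall j k, (mdeg k < mdeg j)%N -> (subst_poly 'X_[j])@_k = 0;
    subst_norm : forall j k, v (subst_poly 'X_[j])@_k <= 1
  }.

Section Substitution.
Variables (R : realType) (F : fieldType) (v : nonarch_absval R F) (n m : nat).
Variable phi : substitution v n m.
Implicit Types (f : mseries n F) (p : {mpoly F[n]}) (k : 'X_{1..m}) (j : 'X_{1..n}).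

Lemma subst_mcoeff p k :
  (phi p)@_k = \sum_(j <- msupp p) p@_j * (phi 'X_[j])@_k.
Proof.
rewrite {1}(mpolyE p) rmorph_sum raddf_sum /=; apply: eq_bigr => j _.
by rewrite subst_polyZ mcoeffZ.
Qed.

Lemma subst_coef_eq0 p k : (forall j, (mdeg j <= mdeg k)%N -> p@_j = 0) ->
  (phi p)@_k = 0.
Proof.
move=> p0; rewrite subst_mcoeff big1 // => j _.
have [jk|kj] := leqP (mdeg j) (mdeg k); first by rewrite p0 // mul0r.
by rewrite subst_ord // mulr0.
Qed.

Lemma subst_coef_le (x : R) p k : 0 <= x -> (forall j, v p@_j <= x) ->
  v (phi p)@_k <= x.
Proof.
move=> x0 px; rewrite subst_mcoeff big_seq_cond.
elim/big_ind: _ => [|a b ax bx|j _]; first by rewrite absval0.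
- by apply: le_trans (absvalD_max v _ _) _; rewrite ge_max ax bx.
- by rewrite absvalM -[x]mulr1 ler_pM ?absval_ge0 ?subst_norm.
Qed.

(** By [subst_ord], monomials of degree above [mdeg k] do not contribute to the coefficient at [k],
    so the truncation loses nothing. *)
Definition ms_subst (f : mseries n F) : mseries m F :=
  MSeries (fun k => (phi (ms_trunc (mdeg k).+1 f))@_k).

Lemma ms_substE f p k : (forall j, (mdeg j <= mdeg k)%N -> p@_j = f j) ->
  ms_subst f k = (phi p)@_k.
Proof.
move=> pf; apply/eqP; rewrite -subr_eq0 -mcoeffB -rmorphB subst_coef_eq0 //.
by move=> j jk; rewrite mcoeffB pf // ms_trunc_le // subrr.
Qed.

Lemma ms_subst_le (x : R) f k : 0 <= x -> (forall j, v (f j) <= x) ->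
  v (ms_subst f k) <= x.
Proof.
move=> x0 fx; apply: subst_coef_le => // j; rewrite coef_ms_truncE.
by case: ifP; rewrite ?absval0.
Qed.

Lemma ms_subst_tate f : f \in tate_pred v (m:=n) -> ms_subst f \in tate_pred v (m:=m).
Proof.
move=> /tate_predP fT; apply/tate_predP => e e0.
(* The tail of [f] is bounded through [subst_coef_le], which is not strict; halving [e] restores
   strictness. The truncation of [f] has a polynomial image, with no coefficients in high degree. *)
have e20 : 0 < e / 2 by rewrite divr_gt0.
have [N fN] := fT _ e20; pose p := ms_trunc N f.
exists (maxn N (msize (phi p))) => k; rewrite geq_max => /andP[Nk pk].
rewrite /= -[X in phi X](subrK p) rmorphD mcoeffD.
rewrite [(phi p)@_k]memN_msupp_eq0 ?msize_mdeg_ge // addr0.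
apply: le_lt_trans (_ : _ <= e / 2) _; last first.
  by rewrite ltr_pdivrMr // ltr_pMr // ltr1n.
apply: subst_coef_le => [|j]; first exact: ltW.
rewrite mcoeffB !coef_ms_truncE; have [jN|Nj] := ltnP (mdeg j) N.
  by rewrite ltnS (leq_trans (ltnW jN)) // subrr absval0 ltW.
by rewrite subr0; case: ifP => _; [apply/ltW/fN|rewrite absval0 ltW].
Qed.

Definition tate_subst (f : tate v n) : tate v m := Tate (ms_subst_tate (tateP f)).

Lemma tate_substE (f : tate v n) p k :
  (forall j, (mdeg j <= mdeg k)%N -> p@_j = f j) -> tate_subst f k = (phi p)@_k.
Proof. exact: ms_substE. Qed.

Lemma tate_subst_trunc d (f : tate v n) k : (mdeg k < d)%N ->
  tate_subst f k = (phi (ms_trunc d f))@_k.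
Proof.
by move=> kd; apply: tate_substE => j jk; rewrite coef_ms_trunc // (leq_ltn_trans jk).
Qed.

Lemma tnorm_subst (f : tate v n) : tnorm (tate_subst f) <= tnorm f.
Proof. by apply: tnorm_le => k; apply: ms_subst_le => [|j]; rewrite ?tnorm_ge0 ?tnorm_ub. Qed.

Fact tate_subst_zmod : zmod_morphism tate_subst.
Proof.
move=> f g; apply: tate_eqP => k; rewrite tcoefB.
rewrite (@tate_substE _ (ms_trunc (mdeg k).+1 f - ms_trunc (mdeg k).+1 g)).
  by rewrite rmorphB mcoeffB.
by move=> j jk; rewrite mcoeffB !ms_trunc_le.
Qed.

Fact tate_subst_monoid : monoid_morphism tate_subst.
Proof.
split=> [|f g]; apply: tate_eqP => k.
  rewrite (@tate_substE _ 1) ?rmorph1 ?mcoeff1 ?tcoef1 // => j _.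
  by rewrite mcoeff1 tcoef1.
rewrite (@tate_substE _ (ms_trunc (mdeg k).+1 f * ms_trunc (mdeg k).+1 g)).
  rewrite rmorphM; symmetry; apply: ms_mul_coef => b bk;
  by rewrite -(@tate_subst_trunc (mdeg k).+1).
by move=> j jk; rewrite ms_mul_trunc.
Qed.

HB.instance Definition _ := GRing.isZmodMorphism.Build _ _ tate_subst tate_subst_zmod.
HB.instance Definition _ := GRing.isMonoidMorphism.Build _ _ tate_subst tate_subst_monoid.

Lemma tate_substC c : tate_subst (tconst v n c) = tconst v m c.
Proof.
apply: tate_eqP => k; rewrite (@tate_substE _ c%:MP); last first.
  by move=> j _; rewrite mcoeffC tcoefC mulr_natr.
by rewrite -[c%:MP]mulr1 mul_mpolyC subst_polyZ rmorph1 mcoeffZ mcoeff1 mulr_natr.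
Qed.

End Substitution.

Lemma tate_subst_comp (R : realType) (F : fieldType) (v : nonarch_absval R F) n m
    (phi : substitution v n m) (psi : substitution v m n) :
  (forall p, psi (phi p) = p) -> cancel (tate_subst phi) (tate_subst psi).
Proof.
move=> phiK f; apply: tate_eqP => k; pose p := ms_trunc (mdeg k).+1 f.
rewrite (@tate_substE _ _ _ _ _ _ _ (phi p)); first by rewrite phiK /p ms_trunc_le.
by move=> j jk; rewrite /p -tate_subst_trunc.
Qed.

Section PolyOrder.
Variables (R : realType) (F : fieldType) (v : nonarch_absval R F) (m : nat).
Implicit Types p q : {mpoly F[m]}.

Definition ord_ge d p := forall k, (mdeg k < d)%N -> p@_k = 0.

Lemma ord_geM a b p q : ord_ge a p -> ord_ge b q -> ord_ge (a + b) (p * q).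
Proof.
move=> pa qb k kab; rewrite mcoeffM big1 // => i /eqP ki.
have [ia|ai] := ltnP (mdeg i.1) a; first by rewrite pa // mul0r.
have kE := congr1 (@mdeg m) ki; rewrite mdegD in kE.
by rewrite qb ?mulr0 // -(ltn_add2l (mdeg i.1)) -kE (leq_trans kab) // leq_add2r.
Qed.

Lemma ord_geX a p n : ord_ge a p -> ord_ge (n * a) (p ^+ n).
Proof. by move=> pa; elim: n => [|n IH] //; rewrite exprS mulSn; apply: ord_geM. Qed.

Lemma ord_ge_prod n (a : 'I_n -> nat) (p : 'I_n -> {mpoly F[m]}) :
  (forall i, ord_ge (a i) (p i)) -> ord_ge (\sum_i a i) (\prod_i p i).
Proof.
move=> pa; elim/big_ind2: _ => // *.
by apply: ord_geM.
Qed.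

Definition coef_le1 p := forall k, v p@_k <= 1.

Lemma coef_le1_1 : coef_le1 1.
Proof. by move=> k; rewrite mcoeff1; case: eqP; rewrite ?absval1 ?absval0. Qed.

Lemma coef_le1M p q : coef_le1 p -> coef_le1 q -> coef_le1 (p * q).
Proof.
move=> p1 q1 k; rewrite mcoeffM; apply: absval_sum_le => // i _.
by rewrite absvalM -[leRHS]mulr1 ler_pM ?absval_ge0.
Qed.

Lemma coef_le1X p n : coef_le1 p -> coef_le1 (p ^+ n).
Proof.
move=> p1; elim: n => [|n IH]; first exact: coef_le1_1.
by rewrite exprS; apply: coef_le1M.
Qed.

Lemma coef_le1_prod n (p : 'I_n -> {mpoly F[m]}) :
  (forall i, coef_le1 (p i)) -> coef_le1 (\prod_i p i).
Proof.
move=> p1; elim/big_ind: _ => //; first exact: coef_le1_1.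
by move=> *; apply: coef_le1M.
Qed.

End PolyOrder.

Section Shear.
Variables (R : realType) (F : fieldType) (v : nonarch_absval R F) (n : nat).
Variables (w : 'I_n.+1 -> nat) (w_gt0 : forall i, (0 < w i)%N).

(** The classical change of variables that makes a series distinguished in the last variable. That
    variable is fixed, so the shears for [c] and [- c] are mutually inverse; positive [w i] keep the
    order from dropping. *)
Definition shear_tuple (c : F) : n.+1.-tuple {mpoly F[n.+1]} :=
  [tuple 'X_i + (c *+ (i != ord_max)) *: 'X_ord_max ^+ w i | i < n.+1].

Section Substitution.
Variables (c : F) (c_le1 : v c <= 1).

Fact shear_ord j k : (mdeg k < mdeg j)%N ->
  ('X_[j] \mPo (shear_tuple c))@_k = 0.
Proof.
rewrite comp_mpolyX (mdegE j); apply: ord_ge_prod => i.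
rewrite -[X in ord_ge X _]muln1; apply: ord_geX; rewrite tnth_mktuple => {}k k0.
have {k0} -> : k = 0%MM by apply/eqP; rewrite -mdeg_eq0; case: (mdeg k) k0.
rewrite mcoeffD mcoeffX mnm1_eq0 add0r mcoeffZ mcoeffXn.
by rewrite -mdeg_eq0 mdegMn mdeg1 mul1n eqn0Ngt w_gt0 mulr0.
Qed.

Fact shear_norm j k : v ('X_[j] \mPo (shear_tuple c))@_k <= 1.
Proof.
rewrite comp_mpolyX; move: k; apply: coef_le1_prod => i; apply: coef_le1X => k.
rewrite tnth_mktuple mcoeffD mcoeffX mcoeffZ mcoeffXn.
apply: le_trans (absvalD_max v _ _) _; rewrite ge_max; apply/andP; split.
  by case: (_ == _); rewrite ?absval1 ?absval0.
rewrite absvalM -[leRHS]mulr1 ler_pM ?absval_ge0 //.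
  by case: (i != _); rewrite ?mulr1n ?mulr0n ?absval0.
by case: (_ == _); rewrite ?absval1 ?absval0.
Qed.

Definition shear : substitution v n.+1 n.+1 :=
  @Substitution R F v _ _ (comp_mpoly (shear_tuple c))
    (fun a p => comp_mpolyZ a p _) shear_ord shear_norm.

End Substitution.

Lemma shearK c c' (c_le1 : v c <= 1) (c'_le1 : v c' <= 1) p :
  c' = - c -> shear c'_le1 (shear c_le1 p) = p.
Proof.
move=> cc'; rewrite /= [p \mPo _]comp_mpolyEX.
rewrite (raddf_sum (comp_mpoly (shear_tuple c'))) [RHS]mpolyE /=.
apply: eq_bigr => j _; rewrite comp_mpolyZ; congr (_ *: _).
rewrite comp_mpolyX rmorph_prod /= mpolyXE_id; apply: eq_bigr => i _.
rewrite rmorphXn /=; congr (_ ^+ _).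
rewrite tnth_mktuple rmorphD /= comp_mpolyZ rmorphXn /= !comp_mpolyXU.
rewrite -!tnth_nth !tnth_mktuple eqxx mulr0n scale0r addr0.
by rewrite cc' mulNrn scaleNr addrAC addrK.
Qed.

End Shear.

(** * Factorial rings and Gauss's lemma *)

Section Factorial.
Variable A : idomainType.
Implicit Types a b c p q u : A.

Definition prime_elt p := [/\ p != 0, p \isn't a GRing.unit &
  forall a b, divides p (a * b) -> divides p a \/ divides p b].

(** The factors are primes rather than irreducibles, which makes the length [n] unique. The length
    alone is what the chain arguments need. *)
Fixpoint nfactors n a : Prop :=
  if n is k.+1 then exists p b, [/\ prime_elt p, nfactors k b & a = p * b]
  else a \is a GRing.unit.

Definition factorial_ring := forall a, a != 0 -> exists n, nfactors n a.

Definition associates a b := exists2 u, u \is a GRing.unit & a = u * b.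

Lemma divides_refl a : divides a a. Proof. by exists 1; rewrite mul1r. Qed.

Lemma divides_trans b a c : divides a b -> divides b c -> divides a c.
Proof. by case=> x -> [y ->]; exists (y * x); rewrite mulrA. Qed.

Lemma divides_mull a b c : divides a b -> divides a (c * b).
Proof. by case=> x ->; exists (c * x); rewrite mulrA. Qed.

Lemma divides_mulr a b c : divides a b -> divides a (b * c).
Proof. by rewrite mulrC; apply: divides_mull. Qed.

Lemma divides_mul2l a b c : c != 0 -> divides (c * a) (c * b) -> divides a b.
Proof. by move=> c0 [x e]; exists x; apply: (mulfI c0); rewrite e mulrCA. Qed.

Lemma unit_divides u a : u \is a GRing.unit -> divides u a.
Proof. by move=> uU; exists (a / u); rewrite divrK. Qed.

Lemma divides_unit a u : divides a u -> u \is a GRing.unit -> a \is a GRing.unit.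
Proof. by case=> c ->; rewrite unitrM => /andP[]. Qed.

Lemma divides_neq0 a b : divides a b -> b != 0 -> a != 0.
Proof. by case=> c ->; apply: contra_neq => ->; rewrite mulr0. Qed.

Lemma associates_sym a b : associates a b -> associates b a.
Proof. by case=> u uU ->; exists u^-1; rewrite ?unitrV // mulKr. Qed.

Lemma associates_trans b a c : associates a b -> associates b c -> associates a c.
Proof. by case=> u uU -> [w wU ->]; exists (u * w); rewrite ?unitrM ?uU ?mulrA. Qed.

Lemma associates_divides a b : associates a b -> divides a b.
Proof. by case/associates_sym=> u uU ->; exists u. Qed.

Lemma associates_neq0 a b : associates a b -> b != 0 -> a != 0.
Proof. by move/associates_divides/divides_neq0. Qed.

Lemma nfactors_unitl n u a : u \is a GRing.unit -> nfactors n a -> nfactors n (u * a).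
Proof.
elim: n a => [|n IH] a uU /=; first by rewrite unitrM uU.
by case=> p [b [pP bn ->]]; exists p, (u * b); split; rewrite ?(mulrCA p) //; apply: IH.
Qed.

Lemma nfactorsM n k a b : nfactors n a -> nfactors k b -> nfactors (n + k) (a * b).
Proof.
elim: n a => [|n IH] a /= an bk; first exact: nfactors_unitl.
case: an => p [c [pP cn ->]]; exists p, (c * b).
by split=> //; [apply: IH | rewrite mulrA].
Qed.

Lemma nfactors_split n a b : nfactors n (a * b) ->
  exists k l, [/\ n = (k + l)%N, nfactors k a & nfactors l b].
Proof.
elim: n a b => [|n IH] a b /=.
  by rewrite unitrM => /andP[aU bU]; exists 0%N, 0%N.
case=> p [c [pP cn e]]; have [p0 _ pdiv] := pP.
have [|[x xE]|[x xE]] := pdiv a b; first by exists c; rewrite e mulrC.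
- have [|k [l [-> xk bl]]] := IH x b.
    suff -> : x * b = c by [].
    by apply: (mulfI p0); rewrite -e xE mulrCA mulrA.
  by exists k.+1, l; split=> //=; exists p, x; split=> //; rewrite mulrC.
- have [|k [l [-> ak xl]]] := IH a x.
    suff -> : a * x = c by [].
    by apply: (mulfI p0); rewrite -e xE mulrCA [p * x]mulrC.
  by exists k, l.+1; rewrite addnS; split=> //=; exists p, x; split=> //; rewrite mulrC.
Qed.

Lemma nfactors_unit n u : u \is a GRing.unit -> nfactors n u -> n = 0%N.
Proof.
case: n => // n uU [p [b [[_ pU _] _ e]]]; case/negP: pU.
by move: uU; rewrite e unitrM => /andP[].
Qed.

Lemma nfactors_prime n p : prime_elt p -> nfactors n p -> n = 1%N.
Proof.
move=> [p0 pU pdiv]; case: n => [|[|n]] //=; first by rewrite (negPf pU).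
case=> q [r [[q0 qU _] rn e]].
have r0 : r != 0 by apply: contra_neq p0 => r0; rewrite e r0 mulr0.
have [|[x xE]|[x xE]] := pdiv q r; first by rewrite -e; exact: divides_refl.
- suff rU : r \is a GRing.unit by have := @nfactors_unit n.+1 r rU rn.
  apply/unitrP; exists x; suff xr : x * r = 1 by split=> //; rewrite mulrC.
  by apply: (mulfI q0); rewrite mulr1 mulrCA -e -xE.
- suff qU' : q \is a GRing.unit by rewrite qU' in qU.
  apply/unitrP; exists x; suff xq : x * q = 1 by split=> //; rewrite mulrC.
  by apply: (mulIf r0); rewrite mul1r -mulrA -e -xE.
Qed.

Lemma nfactors_uniq n k a : nfactors n a -> nfactors k a -> n = k.
Proof.
elim: n k a => [|n IH] k a; first by move=> aU /(nfactors_unit aU).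
case=> p [b [pP bn ->]] /nfactors_split[i [j [-> pi bj]]].
by rewrite (nfactors_prime pP pi) (IH _ _ bn bj).
Qed.

Lemma gcd_ex a b : factorial_ring -> a != 0 -> exists g,
  [/\ divides g a, divides g b & forall c, divides c a -> divides c b -> divides c g].
Proof.
move=> fA /fA[n an]; elim: n a b an => [|n IH] a b.
  move=> aU; exists 1; split=> [||c ca _]; try by apply: unit_divides; rewrite unitr1.
  by apply: unit_divides; apply: divides_unit ca aU.
case=> p [a' [[p0 pU pdiv] a'n ->]].
have [[b' ->]|pNb] := pselect (divides p b).
- have [g [[x xE] [y yE] gP]] := IH a' b' a'n.
  exists (p * g); split=> [||c ca cb].
  + by exists x; rewrite xE mulrCA.
  + by exists y; rewrite yE mulrCA mulrC.
  have [[c' cE]|pNc] := pselect (divides p c).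
    move: ca cb; rewrite cE [c' * p]mulrC [b' * p]mulrC.
    move=> /(divides_mul2l p0) ca /(divides_mul2l p0) cb.
    by have [z ->] := gP _ ca cb; exists z; rewrite mulrCA.
  suff cd d : divides c (p * d) -> divides c d.
    by apply: divides_mull; apply: gP; apply: cd; rewrite // mulrC.
  case=> z zE; have [|[w wE]|//] := pdiv z c; first by exists d; rewrite -zE mulrC.
  by exists w; apply: (mulfI p0); rewrite zE wE mulrAC mulrC.
- have [g [ga gb gP]] := IH a' b a'n; exists g; split=> //.
    exact: divides_mull.
  move=> c [z zE] cb; apply: gP => //.
  have [|[w wE]|pc] := pdiv z c; first by exists a'; rewrite -zE mulrC.
    by exists w; apply: (mulfI p0); rewrite zE wE mulrAC mulrC.
  by case: pNb; apply: divides_trans pc cb.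
Qed.

Lemma prime_divides_prime p q : prime_elt p -> prime_elt q -> divides q p -> divides p q.
Proof.
move=> [p0 _ pdiv] [q0 qU _] [c cE].
have [|[x xE]|//] := pdiv c q; first by rewrite -cE; apply: divides_refl.
case/negP: qU; apply/unitrP; exists x; suff xq : x * q = 1 by split=> //; rewrite mulrC.
by apply: (mulfI p0); rewrite mulr1 [in RHS]cE xE mulrAC mulrC.
Qed.

(** A prime [p] of [a] is added to [s] only if it does not divide [s] yet. If then q^2 divides p s,
    either p divides the cofactor and q^2 divides s, or p divides q and hence s. *)
Lemma radical_ex a : factorial_ring -> a != 0 -> exists s, [/\ divides s a,
  forall p, prime_elt p -> divides p a -> divides p s &
  forall p, prime_elt p -> ~ divides (p ^+ 2) s].
Proof.
move=> fA /fA[n]; elim: n a => [|n IH] a.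
  move=> aU; exists 1; split=> [|p [_ pU _]|p [_ pU _]].
  - by apply: unit_divides; rewrite unitr1.
  - by move=> /divides_unit/(_ aU) pU'; rewrite pU' in pU.
  - by move=> /divides_unit; rewrite unitr1 unitrX_pos // (negPf pU) => /(_ isT).
case=> p [a' [pP /IH[s [sa sP sF]] ->]]; have [p0 pU pdiv] := pP.
have [ps|pNs] := pselect (divides p s).
- exists s; split=> //; first exact: divides_mull.
  move=> q qP; have [_ _ qdiv] := qP; case/qdiv => [qp|]; last exact: sP.
  exact: divides_trans qp ps.
- exists (p * s); split.
  + by case: sa => x ->; exists x; rewrite mulrCA.
  + move=> q qP; have [_ _ qdiv] := qP.
    by case/qdiv => [qp|/(sP _ qP) qs]; [apply: divides_mulr|apply: divides_mull].
  move=> q qP [c cE]; have [q0 _ _] := qP.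
  have [|[c' c'E]|[e pq2]] := pdiv c (q ^+ 2).
    by rewrite -cE; apply/divides_mulr/divides_refl.
    apply: (sF q qP); exists c'; apply: (mulfI p0).
    by rewrite cE c'E mulrAC mulrC.
  have {e pq2} [e qE] : divides p q.
    by have [||] := pdiv q q; first by exists e; rewrite -expr2.
  case: pNs; exists (c * e * e); apply: (mulfI p0).
  by rewrite cE qE; ring.
Qed.

End Factorial.

(** * Chains of divisors in a factorial ring *)

Section ChainStabilises.
Variable A : idomainType.

Lemma nondecreasing_stationary (k : nat -> nat) N : (forall i, (k i <= k i.+1)%N) ->
  (forall i, (k i <= N)%N) -> exists i0, forall i, (i0 <= i)%N -> k i = k i0.
Proof.
move=> kS kN; have km i j : (i <= j)%N -> (k i <= k j)%N.
  by move/subnKC <-; elim: (j - i)%N => [|l IH]; rewrite ?addn0 // addnS (leq_trans IH).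
have kex : exists n, `[< exists i, k i = n >] by exists (k 0%N); apply/asboolP; exists 0%N.
case: (@ex_maxnP _ N kex) => [n /asboolP[i <-]//|n /asboolP[i0 <-] maxP].
exists i0 => i i0i; apply/eqP; rewrite eqn_leq (km _ _ i0i) andbT.
by apply: maxP; apply/asboolP; exists i.
Qed.

Lemma nonincreasing_stationary (k : nat -> nat) : (forall i, (k i.+1 <= k i)%N) ->
  exists i0, forall i, (i0 <= i)%N -> k i = k i0.
Proof.
move=> kS; have k0 i : (k i <= k 0%N)%N by elim: i => // i; apply: leq_trans.
have [||i0 iP] := @nondecreasing_stationary (fun i => k 0 - k i)%N (k 0%N).
- by move=> i; rewrite leq_sub2l.
- by move=> i; rewrite leq_subr.
by exists i0 => i /iP e; rewrite -(subKn (k0 i)) e subKn.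
Qed.

(** The number of prime factors is monotone along the chain and bounded by that of [f]. Where it
    stays constant, the quotients have no prime factor, so they are units. *)
Lemma divisor_chain_stationary (f : A) (d : nat -> A) : factorial_ring A -> f != 0 ->
  (forall i, divides (d i) f) ->
  (forall i, divides (d i) (d i.+1)) \/ (forall i, divides (d i.+1) (d i)) ->
  exists i0, forall i, (i0 <= i)%N -> associates (d i) (d i0).
Proof.
move=> fA f0 df mono; have [N fN] := fA f f0.
have d0 i : d i != 0 := divides_neq0 (df i) f0.
have /choice[k kP] i : exists n, nfactors n (d i) by apply: fA.
have kdiv i j : divides (d i) (d j) -> (k i <= k j)%N /\ (k i = k j -> associates (d j) (d i)).
  move=> [c cE]; have := kP j; rewrite cE => /nfactors_split[l [l' [e cl]]].
  move/(nfactors_uniq (kP i)) => e'; rewrite e -e' leq_addl; split=> // ee.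
  by exists c => //; move: ee cl => /eqP; rewrite -{1}[k i]add0n eqn_add2r => /eqP <-.
have kN i : (k i <= N)%N.
  have [c cE] := df i; move: fN; rewrite cE => /nfactors_split[l [l' [-> _]]].
  by move/(nfactors_uniq (kP i)) ->; rewrite leq_addl.
have dm : (forall i j, (i <= j)%N -> divides (d i) (d j)) \/
          (forall i j, (i <= j)%N -> divides (d j) (d i)).
  case: mono => dS; [left|right] => i j /subnKC <-; elim: (j - i)%N => [|l IH];
  rewrite ?addn0 ?addnS; try exact: divides_refl.
  - exact: divides_trans IH (dS _).
  - exact: divides_trans (dS _) IH.
case: dm => dm.
- have [|i0 iP] := nondecreasing_stationary (k := k) _ kN.
    by move=> i; apply: (kdiv _ _ (dm _ _ (leqnSn i))).1.
  by exists i0 => i i0i; apply: (kdiv _ _ (dm _ _ i0i)).2; rewrite iP.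
- have [|i0 iP] := nonincreasing_stationary (k := k).
    by move=> i; apply: (kdiv _ _ (dm _ _ (leqnSn i))).1.
  by exists i0 => i i0i; apply/associates_sym/(kdiv _ _ (dm _ _ i0i)).2; rewrite iP.
Qed.

End ChainStabilises.

(** * Gauss's lemma over a factorial ring *)

Section Gauss.
Variable B : idomainType.
Implicit Types (p b : B) (G H W : {poly B}).

Lemma divides_polyC p G : (forall i, divides p G`_i) -> divides p%:P G.
Proof.
move/choice=> [c cP]; exists (\poly_(i < size G) c i); apply/polyP => i.
rewrite coefMC coef_poly; case: ltnP => [_|iG]; first exact: cP.
by rewrite nth_default // mul0r.
Qed.

(** If i and j are the least indices of coefficients of G and H not divisible by p, then modulo p
    the coefficient of G H at i + j is the product of these two. *)
Lemma prime_polyC p : prime_elt p -> prime_elt p%:P.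
Proof.
move=> [p0 pU pdiv]; split; first by rewrite polyC_eq0.
  by rewrite poly_unitE coefC eqxx (negPf pU) andbF.
have minNdiv G : ~ divides p%:P G ->
    exists i, ~ divides p G`_i /\ forall j, (j < i)%N -> divides p G`_j.
  move=> pNG; have iex : exists i, `[< ~ divides p G`_i >].
    apply: contra_notP pNG => /forallNP pG; apply: divides_polyC => i.
    by apply: contrapT => pNi; apply: (pG i); apply/asboolP.
  case: (ex_minnP iex) => i /asboolP pNi iM; exists i; split=> // j ji.
  by apply: contrapT => /asboolP/iM; rewrite leqNgt ji.
move=> G H [C CE]; apply: contrapT => /not_orP[/minNdiv[i [pNi iM]] /minNdiv[j [pNj jM]]].
have : divides p (G * H)`_(i + j) by rewrite CE coefMC; exists C`_(i + j).
have ij : (i < (i + j).+1)%N by rewrite ltnS leq_addr.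
rewrite coefM (bigD1 (Ordinal ij)) //= addKn => -[c cE].
have [d dE] : divides p (\sum_(l < (i + j).+1 | l != Ordinal ij) G`_l * H`_(i + j - l)).
  elim/big_ind: _ => [|_ _ [x ->] [y ->]|l li].
  - by exists 0; rewrite mul0r.
  - by exists (x + y); rewrite mulrDl.
  move: li; rewrite -(inj_eq val_inj) neq_ltn => /orP[/iM|/= il].
    exact: divides_mulr.
  apply/divides_mull/jM; have := ltn_ord l; lia.
have [|//|//] := pdiv G`_i H`_j.
by exists (c - d); rewrite mulrBl -cE -dE addrK.
Qed.

(** The primes of [b] stay prime as constant polynomials, so each can be cancelled from [G] or from
    [H] without changing the degree. *)
Lemma gauss_factor n b W G H : nfactors n b -> b *: W = G * H ->
  exists G' H', [/\ W = G' * H', size G' = size G & size H' = size H].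
Proof.
elim: n b G H => [|n IH] b G H /=.
  move=> bU e; exists (b^-1 *: G), H; split=> //.
    by rewrite -scalerAl -e scalerA mulVr // scale1r.
  by rewrite size_scale // invr_eq0; apply: contraTneq bU => ->; rewrite unitr0.
case=> p [b' [/[dup] [[p0 _ _]] /prime_polyC[pp0 _ pdiv] b'n ->]] e.
have sz (K : {poly B}) : size (K * p%:P) = size K by rewrite mulrC mul_polyC size_scale.
have [|[K KE]|[K KE]] := pdiv G H.
- by exists (b' *: W); rewrite -e -scalerA mulrC mul_polyC.
- have [|G' [H' [WE sG sH]]] := IH b' K H b'n.
    by apply: (mulfI pp0); rewrite mul_polyC scalerA e KE; ring.
  by exists G', H'; rewrite KE sz.
- have [|G' [H' [WE sG sH]]] := IH b' G K b'n.
    by apply: (mulfI pp0); rewrite mul_polyC scalerA e KE; ring.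
  by exists G', H'; rewrite KE sz.
Qed.

Hypothesis fB : factorial_ring B.

(* A gcd of W and G over the fraction field, cleared of denominators, gives a
   factorization of W over B by Gauss's lemma. *)
Lemma monic_irreducible_prime W : W \is monic -> (1 < size W)%N ->
  (forall G H, G \is monic -> H \is monic -> W = G * H -> size G = 1%N \/ size H = 1%N) ->
  prime_elt W.
Proof.
move=> Wm W1 Wirr; have W0 := monic_neq0 Wm; split=> //.
  by rewrite poly_unitE; case: eqP W1 => // ->.
(* The leading coefficients of [G] and [H] are inverse to each other, so exchanging them makes both
   factors monic. *)
have Wfactor G H : W = G * H -> size G = 1%N \/ size H = 1%N.
  move=> e; have lGH : lead_coef G * lead_coef H = 1.
    by rewrite -lead_coefM -e (monicP Wm).
  have lHG : lead_coef H * lead_coef G = 1 by rewrite mulrC.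
  have lG0 : lead_coef G != 0 by apply: contra_eq_neq lGH => ->; rewrite mul0r eq_sym oner_eq0.
  have lH0 : lead_coef H != 0 by apply: contra_eq_neq lGH => ->; rewrite mulr0 eq_sym oner_eq0.
  have := Wirr (lead_coef H *: G) (lead_coef G *: H).
  rewrite !size_scale //; apply.
  - by apply/monicP; rewrite lead_coefZ.
  - by apply/monicP; rewrite lead_coefZ.
  - by rewrite -scalerAl -scalerAr scalerA lHG scale1r.
move=> G H [C CE]; have WGH : W %| G * H by apply/Pdiv.IdomainMonic.dvdpP => //; exists C.
have [[c D] /= c0 e] := Pdiv.WeakIdomain.dvdpP _ _ (Pdiv.CommonIdomain.dvdp_gcdl W G).
have [n cn] := fB c0; have [D' [G' [WE sD sG]]] := gauss_factor cn e.
have dvdW K : W %| K -> divides W K.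
  by move=> WK; have [K' ->] := Pdiv.IdomainMonic.dvdpP Wm _ WK; exists K'.
(* Either the gcd of [W] and [G] has the degree of [W], and [W] divides [G], or it is constant and
   [W] divides [H]. *)
have [D1|g1] := Wfactor _ _ WE.
- left; apply: dvdW.
  have D'0 : D' != 0 by rewrite -size_poly_eq0 D1.
  have G'0 : G' != 0 by apply: contra_neq W0; rewrite WE => ->; rewrite mulr0.
  have : gcdp W G %= W.
    rewrite -Pdiv.CommonIdomain.dvdp_size_eqp ?Pdiv.CommonIdomain.dvdp_gcdl //.
    by rewrite [in size W]WE size_mul // D1 add1n sG.
  by move/Pdiv.CommonIdomain.eqp_dvdl => <-; apply: Pdiv.CommonIdomain.dvdp_gcdr.
- right; apply: dvdW; rewrite -(@Pdiv.CommonIdomain.Gauss_dvdpr _ _ G) //.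
  by rewrite Pdiv.CommonIdomain.coprimep_def -sG g1.
Qed.

End Gauss.

(** * Weierstrass division and preparation *)

Section Monomials.
Variables (R : realType) (F : fieldType) (v : nonarch_absval R F) (m : nat).
Local Notation T := (tate v m).

Fact tmon_subproof (j : 'X_{1..m}) : MSeries (fun k => (k == j)%:R : F) \in @tate_pred R F v m.
Proof.
apply/tate_predP => e e0; exists (mdeg j).+1 => k kj /=.
by case: eqP kj => [->|_ _]; rewrite ?ltnn ?absval0.
Qed.

Definition tmon j : T := Tate (tmon_subproof j).

Lemma tcoef_mon j k : tmon j k = (k == j)%:R. Proof. by []. Qed.

Lemma tcoefMmon (f : T) j k : (f * tmon j) k = if (j <= k)%MM then f (k - j)%MM else 0.
Proof.
rewrite -[LHS]/((tate_series f * tate_series (tmon j)) k).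
case: ifP => [jk|/negP jk]; last first.
  rewrite mscoefM big1 // => i /eqP ki; rewrite tcoef_mon.
  case: eqP => [ij|]; last by rewrite mulr0.
  by case: jk; rewrite ki ij lem_addl.
rewrite -[LHS]/(ms_mul f (tmon j) k).
rewrite (@ms_mul_coef _ _ _ _ (ms_trunc (mdeg k).+1 f) 'X_[j]).
- by rewrite -{1}(submK jk) addmC mcoeffMX ms_trunc_le // mdegB.
- by move=> b bk; rewrite ms_trunc_le.
- by move=> b _; rewrite mcoeffX tcoef_mon eq_sym.
Qed.

Lemma tmon0 : tmon 0%MM = 1.
Proof. exact: tate_eqP. Qed.

Lemma tmonD i j : tmon (i + j)%MM = tmon i * tmon j.
Proof.
apply: tate_eqP => k; rewrite tcoefMmon !tcoef_mon.
case: ifP => [jk|/negP jk].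
  by rewrite -{1}(submK jk) eqm_add2r.
by case: eqP => // ke; case: jk; rewrite ke lem_addl.
Qed.

Lemma tmonMn i n : tmon (i *+ n)%MM = tmon i ^+ n.
Proof. by elim: n => [|n IH]; rewrite ?mulm0n ?tmon0 // mulmS tmonD IH exprS. Qed.

Lemma tmonE k : tmon k = \prod_i tmon U_(i)%MM ^+ k i.
Proof.
rewrite {1}(multinomUE_id k) (big_morph tmon tmonD tmon0).
by apply: eq_bigr => i _; rewrite tmonMn.
Qed.

Lemma tnorm_mon j : tnorm (tmon j) <= 1.
Proof.
by apply: tnorm_le => k; rewrite tcoef_mon; case: eqP; rewrite ?absval1 ?absval0 ?ler01.
Qed.

Lemma tnorm_sum (I : finType) (P : pred I) (E : I -> T) (x : R) :
  0 <= x -> (forall i, P i -> tnorm (E i) <= x) -> tnorm (\sum_(i | P i) E i) <= x.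
Proof.
move=> x0 vE; elim/big_ind: _ => //; first by rewrite tnorm0.
by move=> y z; apply: tnormD_le.
Qed.

End Monomials.

Lemma tate_subst_mon (R : realType) (F : fieldType) (v : nonarch_absval R F) n m
    (phi : substitution v n m) j k :
  tate_subst phi (tmon v j) k = (phi 'X_[j])@_k.
Proof. by apply: tate_substE => i _; rewrite mcoeffX eq_sym. Qed.

(** * Series in n + 1 variables and polynomials in the last one *)

Section LastVariable.
Variable n : nat.
Implicit Types (k : 'X_{1..n.+1}) (l : 'X_{1..n}).

Definition mlow k : 'X_{1..n} := [multinom k (widen_ord (leqnSn n) i) | i < n].
Definition mext l d : 'X_{1..n.+1} := (mnmwiden l + U_(ord_max) *+ d)%MM.

Lemma mext_last l d : mext l d ord_max = d.
Proof. by rewrite mnmDE mnmwiden_ordmax mulmnE mnm1E eqxx mul1n. Qed.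

Lemma mlow_mext l d : mlow (mext l d) = l.
Proof.
apply/mnmP => i; rewrite mnmE mnmDE mnmwiden_widen mulmnE mnm1E -val_eqE /=.
by rewrite gtn_eqF ?addn0.
Qed.

Lemma mext_mlow k : mext (mlow k) (k ord_max) = k.
Proof.
apply/mnmP => i; case: (unliftP ord_max i) => [j ->|->]; last exact: mext_last.
have -> : lift ord_max j = widen_ord (leqnSn n) j.
  by apply: val_inj; rewrite /= /bump leqNgt ltn_ord.
by have /mnmP/(_ j) := mlow_mext (mlow k) (k ord_max); rewrite !mnmE.
Qed.

Lemma mdeg_mext l d : mdeg (mext l d) = (mdeg l + d)%N.
Proof.
rewrite mdegD mdegMn mdeg1 mul1n; congr addn.
rewrite !mdegE big_ord_recr /= mnmwiden_ordmax addn0.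
by apply: eq_bigr => i _; rewrite mnmwiden_widen.
Qed.

Lemma mext_inj k k' : mlow k = mlow k' -> k ord_max = k' ord_max -> k = k'.
Proof. by move=> e e'; rewrite -(mext_mlow k) e e' mext_mlow. Qed.

End LastVariable.

Section PolyTate.
Variables (R : realType) (F : fieldType) (v : nonarch_absval R F) (n : nat).
Local Notation B := (tate v n).
Local Notation T := (tate v n.+1).

Fact widen_ord_subproof (j : 'X_{1..n}) (k : 'X_{1..n.+1}) :
  (mdeg k < mdeg j)%N -> (mwiden 'X_[F, j])@_k = 0.
Proof.
rewrite mwidenX mcoeffX; case: eqP => // <-.
by have := mdeg_mext j 0; rewrite addn0 /mext mulm0n addm0 => ->; rewrite ltnn.
Qed.

Fact widen_norm_subproof (j : 'X_{1..n}) (k : 'X_{1..n.+1}) :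
  v (mwiden 'X_[F, j])@_k <= 1.
Proof. by rewrite mwidenX mcoeffX; case: eqP; rewrite ?absval1 ?absval0. Qed.

Definition widening : substitution v n n.+1 :=
  @Substitution R F v _ _ (@mwiden n F) (@mwidenZ n F)
    widen_ord_subproof widen_norm_subproof.

Definition twiden : B -> T := tate_subst widening.
HB.instance Definition _ := GRing.RMorphism.copy twiden (tate_subst widening).

Definition zlast : T := tmon v U_(ord_max)%MM.

Definition tpoly : {poly B} -> T := horner_morph (fun x => mulrC zlast (twiden x)).
HB.instance Definition _ := GRing.RMorphism.copy tpoly
  (horner_morph (fun x => mulrC zlast (twiden x))).

Lemma tcoef_widen (f : B) (k : 'X_{1..n.+1}) :
  twiden f k = if k ord_max == 0%N then f (mlow k) else 0.
Proof.
rewrite /twiden (@tate_subst_trunc _ _ _ _ _ _ (mdeg k).+1) //=.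
case: eqP => [k0|k0].
  have kE : k = mnmwiden (mlow k).
    by rewrite -{1}(mext_mlow k) k0 /mext mulm0n addm0.
  rewrite [X in _@_X]kE mwiden_mnmwiden coef_ms_truncE ifT // ltnS.
  by rewrite -[leqRHS](congr1 (@mdeg _) (mext_mlow k)) mdeg_mext leq_addr.
rewrite (mwidenE (leqnn _)) raddf_sum big1 //= => l _.
rewrite mcoeffZ mcoeffX; case: eqP => [e|]; last by rewrite mulr0.
by case: k0; rewrite -e mnmwiden_ordmax.
Qed.

Lemma tcoef_poly (p : {poly B}) k : tpoly p k = p`_(k ord_max) (mlow k).
Proof.
rewrite /tpoly /horner_morph horner_coef.
have -> : size (map_poly twiden p) = size p.
  apply: size_map_inj_poly; last exact: rmorph0.
  move=> f g fg; apply: tate_eqP => l; have := tcoef_widen f (mext l 0).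
  by rewrite fg tcoef_widen mext_last mlow_mext.
have ev (I : finType) (E : I -> T) : (\sum_i E i) k = \sum_i E i k.
  by elim/big_rec2: _ => // i _ y _ <-.
rewrite ev (eq_bigr (fun i : 'I_(size p) => if k ord_max == i then p`_i (mlow k) else 0)).
  have [kp|pk] := ltnP (k ord_max) (size p).
    rewrite (bigD1 (Ordinal kp)) //= eqxx big1 ?addr0 // => i.
    by rewrite -val_eqE eq_sym => /negPf ->.
  rewrite nth_default // big1 // => i _; case: eqP => // e.
  by have := ltn_ord i; rewrite -e ltnNge pk.
move=> i _; rewrite coef_map -tmonMn tcoefMmon tcoef_widen.
have -> : (U_(ord_max) *+ i <= k)%MM = (i <= k ord_max)%N.
  apply/mnm_lepP/idP => [/(_ ord_max)|ik j]; rewrite mulmnE mnm1E; first by rewrite eqxx mul1n.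
  by case: eqP => [<-|]; rewrite ?mul1n.
have -> : (k - U_(ord_max) *+ i)%MM ord_max = (k ord_max - i)%N.
  by rewrite mnmBE mulmnE mnm1E eqxx mul1n.
have -> : mlow (k - U_(ord_max) *+ i) = mlow k.
  apply/mnmP => j; rewrite [LHS]mnmE [RHS]mnmE mnmBE mulmnE mnm1E -val_eqE /=.
  by rewrite gtn_eqF ?mul0n ?subn0.
by rewrite subn_eq0 eqn_leq; case: (i <= _)%N; rewrite ?andbF ?andbT.
Qed.

Lemma tpolyC (b : B) : tpoly b%:P = twiden b.
Proof. exact: horner_morphC. Qed.

Lemma tpolyX : tpoly 'X = zlast.
Proof. exact: horner_morphX. Qed.

Lemma tpolyB p q : tpoly (p - q) = tpoly p - tpoly q. Proof. exact: rmorphB. Qed.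
Lemma tpolyD p q : tpoly (p + q) = tpoly p + tpoly q. Proof. exact: rmorphD. Qed.
Lemma tpolyM p q : tpoly (p * q) = tpoly p * tpoly q. Proof. exact: rmorphM. Qed.
Lemma tpolyN p : tpoly (- p) = - tpoly p. Proof. exact: rmorphN. Qed.
Lemma tpolyXn d : tpoly 'X^d = zlast ^+ d. Proof. by rewrite rmorphXn /= tpolyX. Qed.

(** The degree bound is stated on coefficients, so that it passes to limits; [deglt_tpolyE] recovers
    the polynomial. *)
Definition deglt d (f : T) := forall k : 'X_{1..n.+1}, (d <= k ord_max)%N -> f k = 0.

Lemma deglt_tpoly d (p : {poly B}) : (size p <= d)%N -> deglt d (tpoly p).
Proof. by move=> pd k dk; rewrite tcoef_poly nth_default // (leq_trans pd). Qed.

Fact slice_subproof (f : T) i : MSeries (fun l => f (mext l i)) \in @tate_pred R F v n.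
Proof.
apply/tate_predP => e e0; have /tate_predP/(_ e e0)[N fN] := tateP f.
by exists N => l Nl; apply: fN; rewrite mdeg_mext (leq_trans Nl) ?leq_addr.
Qed.

Definition slice f i : B := Tate (slice_subproof f i).

Lemma deglt_tpolyE d f : deglt d f -> exists2 p : {poly B}, (size p <= d)%N & f = tpoly p.
Proof.
move=> fd; exists (\poly_(i < d) slice f i); first exact: size_poly.
apply: tate_eqP => k; rewrite tcoef_poly coef_poly.
case: ltnP => [_|/fd -> //].
by rewrite -[in LHS](mext_mlow k).
Qed.

End PolyTate.

Section Weierstrass.
Variables (R : realType) (F : fieldType) (v : nonarch_absval R F) (n : nat).
Local Notation B := (tate v n).
Local Notation T := (tate v n.+1).
Implicit Types p W G H : {poly B}.
Hypothesis v_complete : absval_complete v.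

Lemma deglt_lim d (u : nat -> T) s (C x : R) : 0 <= x < 1 ->
  (forall i, deglt d (u i)) -> (forall i, tnorm (s - u i) <= C * x ^+ i) -> deglt d s.
Proof.
move=> x01 ud su k dk; apply/(absval_eq0 v)/eqP; rewrite eq_le absval_ge0 andbT.
apply: (geometric_le0 (C := C) x01) => i; apply: le_trans (su i).
by rewrite -[s k]subr0 -(ud i k dk) -tcoefB tnorm_ub.
Qed.

(* The coefficient of [q * W] at [k + d * e_last], where [k] has maximal last
   exponent among the dominant monomials of [q], is dominated by no other term. *)
Lemma division_estimate d (W : {poly B}) (q r : T) :
  W \is monic -> size W = d.+1 -> tnorm (tpoly W) <= 1 -> deglt d r ->
  tnorm q <= tnorm (q * tpoly W + r).
Proof.
move=> Wm Wd W1 rd; have [->|q0] := eqVneq q 0; first by rewrite tnorm0 tnorm_ge0.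
have [k [qk kM]] := tate_leading_by (fun k : 'X_{1..n.+1} => k ord_max) q0.
have Wl (l : 'X_{1..n.+1}) : l ord_max = d -> tpoly W l = (mlow l == 0%MM)%:R.
  by move=> ld; rewrite tcoef_poly ld -[d]/(d.+1.-1) -Wd -lead_coefE (monicP Wm).
pose l : 'X_{1..n.+1} := mext 0 d; have ld : l ord_max = d by rewrite mext_last.
have Wl1 : v (tpoly W l) = 1 by rewrite Wl // mlow_mext eqxx absval1.
have q_gt0 : 0 < tnorm q by rewrite tnorm_gt0.
have E : v ((q * tpoly W) (k + l)%MM) = tnorm q.
  rewrite -[LHS]/(v ((tate_series q * tate_series (tpoly W)) (k + l)%MM)).
  rewrite mscoefM_dom -?qk ?Wl1 ?mulr1 // => k' l' e k'k.
  have elast : (k' ord_max + l' ord_max = k ord_max + d)%N.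
    by rewrite -ld -!mnmDE e.
  (* If the last exponent of [l'] is below [d], that of [k'] exceeds that of [k], where [q] is
     smaller. Above [d], [W] vanishes. At [d], [W] being monic leaves only [l]. *)
  have [l'd|dl'|l'd] := ltngtP (l' ord_max) d.
  - apply: le_lt_trans (_ : _ <= v (q k') * 1) _.
      by rewrite ler_wpM2l ?absval_ge0 // (le_trans (tnorm_ub _ _)).
    rewrite mulr1 kM // ltEnat /=; lia.
  - by rewrite tcoef_poly nth_default ?Wd // absval0 mulr0.
  rewrite Wl //; case: eqP => [l0|]; last by rewrite absval0 mulr0.
  suff /eqP kk : k' == k by rewrite kk eqxx in k'k.
  have l'l : l' = l by apply: mext_inj; rewrite ?mlow_mext ?ld.
  by move: e; rewrite l'l => /addIm ->.
rewrite -{1}E; apply: le_trans (tnorm_ub _ (k + l)%MM).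
by rewrite tcoefD rd ?addr0 // mnmDE ld leq_addl.
Qed.

Lemma division_uniq d (W : {poly B}) (q r : T) :
  W \is monic -> size W = d.+1 -> tnorm (tpoly W) <= 1 -> deglt d r ->
  q * tpoly W + r = 0 -> q = 0 /\ r = 0.
Proof.
move=> Wm Wd W1 rd e; have := division_estimate q Wm Wd W1 rd.
rewrite e tnorm0 le_eqVlt ltNge tnorm_ge0 orbF tnorm_eq0 => /eqP q0.
by split=> //; move: e; rewrite q0 mul0r add0r.
Qed.

Lemma tate_poly_approx (g : T) (e : R) : 0 < e -> exists p : {poly B},
  tnorm (tpoly p) <= tnorm g /\ tnorm (g - tpoly p) <= e.
Proof.
move=> e0; have /tate_predP/(_ e e0)[N gN] := tateP g.
have pT : MSeries (fun k => if (mdeg k < N)%N then g k else 0) \in @tate_pred R F v n.+1.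
  by apply/tate_predP => e' e'0; exists N => k /=; rewrite leqNgt => /negPf ->; rewrite absval0.
have [|p _ pE] := @deglt_tpolyE _ _ v n N (Tate pT).
  move=> k Nk /=; rewrite ltnNge (leq_trans Nk) // -[in leqRHS](mext_mlow k).
  by rewrite mdeg_mext leq_addl.
exists p; rewrite -pE; split; apply: tnorm_le => k.
  by rewrite /=; case: ifP; rewrite ?tnorm_ub // absval0 tnorm_ge0.
rewrite tcoefB /=; case: ltnP => [_|/gN/ltW]; last by rewrite subr0.
by rewrite subrr absval0 ltW.
Qed.

(** Successive approximation: Euclidean division by [W] of a polynomial close to the current
    residual shrinks the residual by the factor [x], and completeness sums the quotients and
    remainders. *)
Lemma weierstrass_division d (W : {poly B}) (h g : T) :
  W \is monic -> size W = d.+1 -> tnorm (tpoly W) <= 1 -> tnorm h < 1 ->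
  exists q r, [/\ g = q * (tpoly W + h) + r, deglt d r & tnorm q <= tnorm g].
Proof.
move=> Wm Wd W1 h1; set f := tpoly W + h.
(* The 1/2 keeps [x] positive when [h] is 0, so that the tolerance of the polynomial approximation
   is positive. *)
pose x := Num.max (tnorm h) (2^-1).
have x0 : 0 < x by rewrite lt_max invr_gt0 ltr0n orbT.
have x01 : 0 <= x < 1 by rewrite ltW // gt_max h1 invf_lt1 ?ltr0n ?ltr1n.
have f1 : tnorm f <= 1 by rewrite tnormD_le // ltW.
have step (u : T) : exists qr : T * T, [/\ deglt d qr.2, tnorm qr.1 <= tnorm u,
    tnorm qr.2 <= tnorm u & tnorm (u - (qr.1 * f + qr.2)) <= x * tnorm u].
  have [->|u0] := eqVneq u 0.
    by exists (0, 0); rewrite /= mul0r !addr0 subr0 tnorm0 mulr0; split.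
  have [|P [Pu uP]] := @tate_poly_approx u (x * tnorm u).
    by rewrite mulr_gt0 // tnorm_gt0.
  pose q := tpoly (rdivp P W); pose r := tpoly (rmodp P W).
  have PE : tpoly P = q * tpoly W + r.
    by rewrite /q /r -tpolyM -tpolyD -rdivp_eq.
  have rd : deglt d r.
    by apply: deglt_tpoly; rewrite -ltnS -Wd ltn_rmodp monic_neq0.
  have qu : tnorm q <= tnorm u.
    by apply: le_trans (division_estimate q Wm Wd W1 rd) _; rewrite -PE.
  exists (q, r); split=> //=.
    have -> : r = tpoly P - q * tpoly W by rewrite PE addrC addKr.
    apply: tnormB_le => //; rewrite tnormM -[leRHS]mulr1.
    by rewrite ler_pM ?tnorm_ge0.
  have -> : u - (q * f + r) = (u - tpoly P) - q * h by rewrite PE /f; ring.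
  apply: tnormB_le => //; rewrite tnormM mulrC ler_pM ?tnorm_ge0 //.
  by rewrite le_max lexx.
have [qr qrP] := choice step.
pose u i := iter i (fun u => u - ((qr u).1 * f + (qr u).2)) g.
have ug i : tnorm (u i) <= tnorm g * x ^+ i.
  elim: i => [|i IH]; first by rewrite mulr1.
  have [_ _ _ /le_trans] := qrP (u i); apply.
  by rewrite exprSr mulrA mulrC ler_wpM2r // ltW.
pose Q i := \sum_(j < i) (qr (u j)).1; pose S i := \sum_(j < i) (qr (u j)).2.
have gE i : g - (Q i * f + S i) = u i.
  elim: i => [|i IH]; first by rewrite /Q /S !big_ord0 mul0r addr0 subr0.
  have -> : u i.+1 = u i - ((qr (u i)).1 * f + (qr (u i)).2) by [].
  rewrite /Q /S !big_ord_recr -/(Q i) -/(S i) /=.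
  by move: (qr (u i)).1 (qr (u i)).2 => a b; rewrite -IH; ring.
have Sd i : deglt d (S i).
  move=> k dk; rewrite /S; elim/big_ind: _ => // [a b a0 b0|j _].
    by rewrite tcoefD a0 b0 addr0.
  by have [rd _ _ _] := qrP (u j); apply: rd.
have [i|q qP] := @tate_complete _ _ _ _ v_complete Q (tnorm g) x x01 (tnorm_ge0 g).
  rewrite /Q big_ord_recr /= addrAC subrr add0r.
  by have [_ h2 _ _] := qrP (u i); apply: le_trans h2 (ug i).
have [i|r rP] := @tate_complete _ _ _ _ v_complete S (tnorm g) x x01 (tnorm_ge0 g).
  rewrite /S big_ord_recr /= addrAC subrr add0r.
  by have [_ _ h2 _] := qrP (u i); apply: le_trans h2 (ug i).
exists q, r; split; last 1 first.
- by have := qP 0%N; rewrite /Q big_ord0 subr0 mulr1.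
- apply/eqP; rewrite -subr_eq0; apply/eqP.
  apply: (@tnorm_lim_eq0 _ _ _ _ _ (tnorm g) x) => // i.
  have -> : g - (q * f + r) = u i - ((q - Q i) * f + (r - S i)) by rewrite -gE; ring.
  apply: tnormB_le => //; apply: tnormD_le => //.
  by rewrite tnormM -[leRHS]mulr1 ler_pM ?tnorm_ge0.
- exact: (deglt_lim (u := S) (C := tnorm g) x01).
Qed.

(** Dividing the d-th power of the last variable by the series gives a remainder of degree below d;
    their difference is the polynomial sought, and the quotient is the unit. *)
Lemma weierstrass_preparation d (W0 : {poly B}) (h : T) :
  W0 \is monic -> size W0 = d.+1 -> tnorm (tpoly W0) <= 1 -> tnorm h < 1 ->
  exists (W : {poly B}) q, [/\ W \is monic, tnorm (tpoly W) <= 1,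
    q \is a GRing.unit & tpoly W = q * (tpoly W0 + h)].
Proof.
move=> W0m W0d W01 h1.
have zd1 : tnorm (zlast v n ^+ d) <= 1 by rewrite -tmonMn tnorm_mon.
have [q [r [zE rd qz]]] := weierstrass_division (zlast v n ^+ d) W0m W0d W01 h1.
have [p pd rE] := deglt_tpolyE rd.
have Wlead : lead_coef ('X^d - p) = 1.
  by rewrite lead_coefDl ?lead_coefXn // size_polyXn size_polyN ltnS.
have Wsize : size ('X^d - p) = d.+1.
  by rewrite size_polyDl ?size_polyXn // size_polyN ltnS.
have WE : tpoly ('X^d - p) = q * (tpoly W0 + h).
  by rewrite tpolyB tpolyXn zE rE addrK.
have q1 : tnorm q <= 1 by exact: le_trans qz zd1.
exists ('X^d - p), q; split=> //; first exact/monicP.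
  rewrite WE tnormM -[leRHS]mulr1 ler_pM ?tnorm_ge0 //.
  by apply: tnormD_le => //; apply: ltW.
rewrite -[q](subrK 1) addrC; apply: unit_1D => //.
have Wrd : deglt d (tpoly (W0 - ('X^d - p))).
  apply: deglt_tpoly; apply/leq_sizeP => j dj; rewrite coefB.
  move: dj; rewrite leq_eqVlt => /orP[/eqP <-|dj]; last first.
    by rewrite !nth_default ?subrr ?Wsize ?W0d.
  have := monicP W0m; rewrite lead_coefE W0d => ->.
  by move: Wlead; rewrite lead_coefE Wsize => ->; rewrite subrr.
(* [q - 1] is the quotient and W0 - W the remainder in a division of - q h by [W0], so its norm is
   at most that of q h, which is below 1. *)
apply: le_lt_trans (division_estimate _ W0m W0d W01 Wrd) _.
have -> : (q - 1) * tpoly W0 + tpoly (W0 - ('X^d - p)) = - (q * h).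
  by rewrite tpolyB WE; ring.
rewrite tnormN tnormM; apply: le_lt_trans h1.
by rewrite -[leRHS]mul1r ler_pM ?tnorm_ge0.
Qed.

(** Weierstrass division and its uniqueness identify T modulo [W] with [{poly B}] modulo [W]. *)
Lemma prime_tpoly W : W \is monic -> tnorm (tpoly W) <= 1 -> prime_elt W ->
  prime_elt (tpoly W).
Proof.
move=> Wm W1 [W0 WU Wdiv].
have Wd : size W = (size W).-1.+1 by rewrite prednK // size_poly_gt0.
have d0 : (0 < (size W).-1)%N.
  rewrite lt0n; apply: contraNneq WU => d0; rewrite d0 in Wd.
  have := monicP Wm; rewrite lead_coefE d0 (size1_polyC (eq_leq Wd)) coefC eqxx.
  by move=> ->; rewrite unitr1.
have r1 : deglt (size W).-1 (- 1 : T).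
  move=> k dk; rewrite tcoefN tcoef1; case: eqP => [k0|_]; last by rewrite oppr0.
  by move: dk; rewrite k0 mnm0E leqNgt d0.
have deglt0 : deglt (size W).-1 (0 : T) by [].
have inj p : tpoly p = 0 -> p = 0.
  move=> p0; apply/polyP => i; apply: tate_eqP => l.
  have := tcoef_poly p (mext l i); rewrite p0 mext_last mlow_mext => <-.
  by rewrite coef0.
split.
- apply: contraNneq (oner_neq0 T) => tW0; have := division_uniq (q := 1) Wm Wd W1 deglt0.
  by rewrite tW0 mulr0 addr0 => -[|-> _].
- apply/negP => /unitrP[u [uW _]]; have := division_uniq (q := u) Wm Wd W1 r1.
  by rewrite uW subrr => -[//|_ /eqP]; rewrite oppr_eq0 oner_eq0.
move=> f g [c cE]; have h1 : tnorm (0 : T) < 1 by rewrite tnorm0.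
have rem (u : T) : exists (q : T) p, u = q * tpoly W + tpoly p.
  have [q [r [uE /deglt_tpolyE[p _ rE] _]]] := weierstrass_division u Wm Wd W1 h1.
  by exists q, p; rewrite uE addr0 rE.
have [qf [pf fE]] := rem f; have [qg [pg gE]] := rem g.
have sd : (size (rmodp (pf * pg) W) <= (size W).-1)%N.
  by rewrite -ltnS -Wd ltn_rmodp.
have pE := rdivp_eq Wm (pf * pg).
have [_ s0] : c - (qf * g + tpoly pf * qg) - tpoly (rdivp (pf * pg) W) = 0 /\
    - tpoly (rmodp (pf * pg) W) = 0.
  apply: (division_uniq (d := (size W).-1) Wm Wd W1).
    by rewrite -tpolyN; apply: deglt_tpoly; rewrite size_polyN.
  have := congr1 (@tpoly _ _ _ _) pE; rewrite tpolyD !tpolyM => tE.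
  have -> : tpoly (rmodp (pf * pg) W) =
    tpoly pf * tpoly pg - tpoly (rdivp (pf * pg) W) * tpoly W by rewrite tE addrC addKr.
  have -> : (c - (qf * g + tpoly pf * qg) - tpoly (rdivp (pf * pg) W)) * tpoly W =
    c * tpoly W - (qf * g + tpoly pf * qg) * tpoly W - tpoly (rdivp (pf * pg) W) * tpoly W.
    by ring.
  by rewrite -cE [in f * g]fE gE; ring.
have m0 : rmodp (pf * pg) W = 0 by apply: inj; apply/eqP; rewrite -oppr_eq0 s0.
have [|[w wE]|[w wE]] := Wdiv pf pg.
- by exists (rdivp (pf * pg) W); rewrite {1}pE m0 addr0.
- by left; exists (qf + tpoly w); rewrite fE wE tpolyM mulrDl.
- by right; exists (qg + tpoly w); rewrite gE wE tpolyM mulrDl.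
Qed.

(** Induction on the degree. Monic polynomials have norm at least 1 and the norm is multiplicative,
    so monic factors of [W] inherit the bound 1 that division requires. *)
Lemma nfactors_tpoly W : factorial_ring B -> W \is monic -> tnorm (tpoly W) <= 1 ->
  exists k, nfactors k (tpoly W).
Proof.
move=> fB; move: {2}(size W) (leqnn (size W)) => N; elim: N W => [|N IH] W WN Wm W1.
  by move: (monic_neq0 Wm); rewrite -size_poly_gt0 ltnNge WN.
have [s1|W_gt1] := leqP (size W) 1.
  exists 0%N => /=; have := monicP Wm.
  rewrite lead_coefE (size1_polyC s1) size_polyC; case: (_ != 0); rewrite coefC /= => ->;
  by rewrite rmorph1 unitr1.
have monic_ge1 G : G \is monic -> 1 <= tnorm (tpoly G).
  move=> Gm; rewrite -(absval1 v); apply: le_trans (tnorm_ub _ (mext 0 (size G).-1)).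
  by rewrite tcoef_poly mext_last mlow_mext -lead_coefE (monicP Gm) tcoef1 eqxx.
have [[G [H [Gm Hm WE [G1 H1]]]]|irr] := pselect (exists G H, [/\ G \is monic,
    H \is monic, W = G * H & (size G != 1%N) /\ (size H != 1%N)]).
- have := W1; rewrite WE tpolyM tnormM => GH1.
  have sGH : (size W = (size G + size H).-1)%N by rewrite WE size_mul ?monic_neq0.
  have G0 : (0 < size G)%N by rewrite size_poly_gt0 monic_neq0.
  have H0 : (0 < size H)%N by rewrite size_poly_gt0 monic_neq0.
  have [||a an] := IH G _ Gm; first by lia.
    apply: le_trans GH1; rewrite -[leLHS]mulr1 ler_wpM2l ?tnorm_ge0 ?monic_ge1 //.
  have [||b bn] := IH H _ Hm; first by lia.
    apply: le_trans GH1; rewrite -[leLHS]mul1r ler_wpM2r ?tnorm_ge0 ?monic_ge1 //.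
  by exists (a + b)%N; apply: nfactorsM.
- exists 1%N, (tpoly W), 1; rewrite /= mulr1 unitr1; split=> //.
  apply: prime_tpoly => //; apply: monic_irreducible_prime => // G H Gm Hm WE.
  apply: contrapT => /not_orP[/eqP G1 /eqP H1]; apply: irr.
  by exists G, H.
Qed.

End Weierstrass.

(** * Tate algebras are factorial *)

(** Uniqueness of expansions in base [N]; it separates the weights of the dominant monomials. *)
Lemma digits_inj N n (a b : 'I_n -> nat) : (0 < N)%N ->
  (forall i, a i < N)%N -> (forall i, b i < N)%N ->
  (\sum_i a i * N ^ (n - i.+1) = \sum_i b i * N ^ (n - i.+1))%N -> a =1 b.
Proof.
move=> N0; elim: n a b => [|n IH] a b aN bN; first by move=> _ [].
have E (c : 'I_n.+1 -> nat) : (\sum_i c i * N ^ (n.+1 - i.+1) =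
    (\sum_(i < n) c (widen_ord (leqnSn n) i) * N ^ (n - i.+1)) * N + c ord_max)%N.
  rewrite big_ord_recr /= subnn muln1 big_distrl; congr addn.
  apply: eq_bigr => i _ /=; rewrite -mulnA -expnSr; congr (_ * _ ^ _)%N.
  by have := ltn_ord i; lia.
rewrite !E => e i.
have em : a ord_max = b ord_max.
  by have := congr1 (modn^~ N) e; rewrite !modnMDl !modn_small.
case: (unliftP ord_max i) => [j ->|->//].
have -> : lift ord_max j = widen_ord (leqnSn n) j.
  by apply: val_inj; rewrite /= /bump leqNgt ltn_ord.
pose wid := widen_ord (leqnSn n).
apply: (IH (a \o wid) (b \o wid)) => // [k|k|]; rewrite /= ?aN ?bN //.
by move/eqP: e; rewrite em eqn_add2r eqn_pmul2r // => /eqP.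
Qed.

Section MonicDegree.
Variable B : idomainType.
Implicit Types p q : {poly B}.

Definition monic_deg d p := p \is monic /\ size p = d.+1.

Lemma monic_degM a b p q : monic_deg a p -> monic_deg b q -> monic_deg (a + b) (p * q).
Proof.
move=> [pm pa] [qm qb]; split; first by rewrite monicMl.
by rewrite size_mul ?monic_neq0 // pa qb addSn addnS.
Qed.

Lemma monic_deg1 : monic_deg 0 1.
Proof. by split; rewrite ?monic1 ?size_poly1. Qed.

Lemma monic_degX a p n : monic_deg a p -> monic_deg (n * a) (p ^+ n).
Proof.
move=> pa; elim: n => [|n IH]; first exact: monic_deg1.
by rewrite exprS mulSn; apply: monic_degM.
Qed.

Lemma monic_deg_prod n (a : 'I_n -> nat) (p : 'I_n -> {poly B}) :
  (forall i, monic_deg (a i) (p i)) -> monic_deg (\sum_i a i) (\prod_i p i).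
Proof.
move=> pa; elim/big_ind2: _ => // [|*]; first exact: monic_deg1.
exact: monic_degM.
Qed.

Lemma monic_degXn d : monic_deg d 'X^d.
Proof. by split; rewrite ?monicXn ?size_polyXn. Qed.

Lemma monic_deg_XnaddC d c : (0 < d)%N -> monic_deg d ('X^d + c%:P).
Proof. by move=> d0; split; rewrite ?monicXnaddC ?size_XnaddC. Qed.

End MonicDegree.

Section Isomorphism.
Variables (A A' : idomainType) (f : {rmorphism A -> A'}) (g : {rmorphism A' -> A}).
Hypotheses (fK : cancel f g) (gK : cancel g f).

Lemma prime_elt_iso p : prime_elt p -> prime_elt (f p).
Proof.
move=> [p0 pU pdiv]; split.
- by apply: contra_neq p0 => /(congr1 g); rewrite fK rmorph0.
- by apply: contra pU => /(rmorph_unit g); rewrite fK.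
move=> a b [c cE]; have [|[d dE]|[d dE]] := pdiv (g a) (g b).
- by exists (g c); rewrite -rmorphM cE rmorphM fK.
- by left; exists (f d); rewrite -rmorphM -dE gK.
- by right; exists (f d); rewrite -rmorphM -dE gK.
Qed.

Lemma nfactors_iso k a : nfactors k a -> nfactors k (f a).
Proof.
elim: k a => [|k IH] a /=; first exact: rmorph_unit.
move=> [p [b [pP /IH bk ->]]]; exists (f p), (f b).
by split; rewrite ?rmorphM //; apply: prime_elt_iso.
Qed.

End Isomorphism.

Section Distinguished.
Variables (R : realType) (F : fieldType) (v : nonarch_absval R F) (n : nat).
Local Notation B := (tate v n).
Local Notation T := (tate v n.+1).
Variables (w : 'I_n.+1 -> nat) (w_gt0 : forall i, (0 < w i)%N) (w_last : w ord_max = 1%N).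

Variable c1 : v 1 <= 1.
Local Notation sigma := (tate_subst (shear w_gt0 c1)).

(** The sheared monomial [k], read as a polynomial in the last variable; it is monic of degree
    [weight k]. *)
Definition shear_poly (k : 'X_{1..n.+1}) : {poly B} :=
  (\prod_(i < n) ('X^(w (widen_ord (leqnSn n) i)) + (tmon v U_(i)%MM)%:P)
      ^+ k (widen_ord (leqnSn n) i)) * 'X^(k ord_max).

Definition weight (k : 'X_{1..n.+1}) := (\sum_i k i * w i)%N.

Lemma shear_poly_monic k : monic_deg (weight k) (shear_poly k).
Proof.
rewrite /weight big_ord_recr /= w_last muln1.
apply: monic_degM (monic_degXn _ _); apply: monic_deg_prod => i.
exact/monic_degX/monic_deg_XnaddC.
Qed.

Lemma shear_tmon k : sigma (tmon v k) = tpoly (shear_poly k).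
Proof.
have X1 i : sigma (tmon v U_(i)%MM) =
    tmon v U_(i)%MM + (tconst v _ (1 *+ (i != ord_max))) * tmon v (U_(ord_max) *+ w i)%MM.
  apply: tate_eqP => j; rewrite tate_subst_mon tcoefD tcoefCM !tcoef_mon /=.
  rewrite comp_mpolyXU -tnth_nth tnth_mktuple mcoeffD mcoeffX mcoeffZ mcoeffXn.
  by rewrite ![_ == j]eq_sym.
rewrite tmonE rmorph_prod big_ord_recr /= /shear_poly tpolyM tpolyXn.
rewrite [tpoly (\prod_i _)]rmorph_prod; congr (_ * _).
  apply: eq_bigr => i _; rewrite !rmorphXn /= X1; congr (_ ^+ _).
  have -> : (widen_ord (leqnSn n) i != ord_max) by rewrite -val_eqE /= ltn_eqF.
  rewrite mulr1n rmorph1 mul1r tpolyD tpolyXn tpolyC tmonMn addrC; congr (_ + _).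
  apply: tate_eqP => j; rewrite /twiden tate_subst_mon /= mwidenX mnmwiden1 mcoeffX.
  by rewrite eq_sym.
by rewrite rmorphXn /= X1 eqxx mulr0n rmorph0 mul0r addr0.
Qed.

Lemma tnorm_shear_poly k : tnorm (tpoly (shear_poly k)) <= 1.
Proof. by rewrite -shear_tmon (le_trans (tnorm_subst _ _)) // tnorm_mon. Qed.

End Distinguished.

Section TateFactorial.
Variables (R : realType) (F : fieldType) (v : nonarch_absval R F).
Hypothesis v_complete : absval_complete v.

(* With weights N^n, ..., N, 1, where N bounds the exponents of the dominant
   monomials of f, these monomials have distinct weights, hence their images
   under the shear have distinct degrees in the last variable. *)
Lemma tate_distinguished n (f : tate v n.+1) : f != 0 ->
  exists (sigma tau : {rmorphism tate v n.+1 -> tate v n.+1}) a d (W : {poly tate v n}) h,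
    [/\ cancel sigma tau, cancel tau sigma, a != 0 & [/\ monic_deg d W,
      tnorm (tpoly W) <= 1, tnorm h < 1 & sigma f = tconst v _ a * (tpoly W + h)]].
Proof.
move=> f0; have x0 : 0 < tnorm f by rewrite tnorm_gt0.
have /tate_predP/(_ _ x0)[N fN] := tateP f.
pose w (i : 'I_n.+1) := (N.+1 ^ (n.+1 - i.+1))%N.
have w_gt0 i : (0 < w i)%N by rewrite expn_gt0.
have w_last : w ord_max = 1%N by rewrite /w subnn.
pose K := [pred k : 'X_{1..n.+1 < N} | v (f k) == tnorm f].
have [k0 fk0] := tnorm_attained f.
have k0N : (mdeg k0 < N)%N by rewrite ltnNge; apply/negP => /fN; rewrite fk0 ltxx.
have K0 : K (BMultinom k0N) by rewrite /= fk0.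
case: (@arg_maxnP _ (BMultinom k0N) K (fun k => weight w k) K0) => k kK kmax.
have weight_lt (l : 'X_{1..n.+1 < N}) : K l -> l != k -> (weight w l < weight w k)%N.
  move=> lK lk; rewrite ltn_neqAle (kmax l lK : (_ <= _)%N) andbT.
  apply: contraNneq lk => e.
  have small (j : 'X_{1..n.+1 < N}) i : (j i < N.+1)%N.
    rewrite ltnW // ltnS (leq_trans _ (bmdeg j)) // ltnS mdegE (bigD1 i) //=.
    exact: leq_addr.
  by apply/eqP/val_inj/mnmP/(digits_inj (N := N.+1)) => //; apply: small.
pose a := f k; have va : v a = tnorm f by apply/eqP.
have a0 : a != 0 by rewrite -(absval_gt0 v) va.
(* The sheared dominant part of [f], divided by the coefficient [a] of greatest weight and hence
   monic. The remaining terms [h0] of [f] have smaller norm and give [h]. *)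
pose W := \sum_(l | K l) (tconst v n (a^-1 * f l))%:P * shear_poly v w l.
pose h0 := f - \sum_(l | K l) tconst v _ (f l) * tmon v l.
have c1 : v 1 <= 1 by rewrite absval1.
have c1' : v (- 1) <= 1 by rewrite absvalN.
pose sigma := tate_subst (shear w_gt0 c1); pose tau := tate_subst (shear w_gt0 c1').
pose h := tconst v _ a^-1 * sigma h0.
have h0lt : tnorm h0 < tnorm f.
  apply: tnorm_lt => l; rewrite /h0 tcoefB.
  have -> : (\sum_(l | K l) tconst v _ (f l) * tmon v l) l =
      \sum_(j | K j) f j * (l == j)%:R.
    by elim/big_rec2: _ => // j _ y _ <-; rewrite tcoefD tcoefCM.
  have [lN|Nl] := ltnP (mdeg l) N; last first.
    rewrite big1 ?subr0 ?fN // => j _; case: eqP => [e|]; rewrite ?mulr0 //.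
    by have := bmdeg j; rewrite -e ltnNge Nl.
  have [lK|lNK] := boolP (K (BMultinom lN)).
    rewrite (bigD1 (BMultinom lN)) //= eqxx mulr1 big1 ?addr0 ?subrr ?absval0 // => j.
    by case/andP=> _ jl; case: eqP => [e|]; rewrite ?mulr0 //; case/eqP: jl; apply: val_inj.
  rewrite big1 ?subr0 => [|j jK].
    by rewrite lt_neqAle tnorm_ub andbT.
  case: eqP => [e|]; rewrite ?mulr0 //; case/negP: lNK.
  by have -> : BMultinom lN = j by apply: val_inj.
exists sigma, tau, a, (weight w k), W, h; split=> //.
- by apply: tate_subst_comp => p; apply: shearK.
- by apply: tate_subst_comp => p; apply: shearK; rewrite opprK.
pose W' := \sum_(l | K l && (l != k)) (tconst v n (a^-1 * f l))%:P * shear_poly v w l.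
have WE : W = shear_poly v w k + W'.
  have E : a^-1 * f k = 1 by rewrite mulVf.
  have -> : shear_poly v w k = (tconst v n (a^-1 * f k))%:P * shear_poly v w k.
    by rewrite E (tconst1 v n) polyC1 mul1r.
  by rewrite /W (bigD1 k).
have [km ks] := shear_poly_monic v w_gt0 w_last k.
have small : (size W' < size (shear_poly v w k))%N.
  rewrite ks ltnS /W'; elim/big_ind: _ => [|p q ps qs|l /andP[lK lk]].
  - by rewrite size_poly0.
  - by apply: leq_trans (size_polyD _ _) _; rewrite geq_max ps.
  rewrite mul_polyC (leq_trans (size_scale_leq _ _)) //.
  by have [_ ->] := shear_poly_monic v w_gt0 w_last l; apply: weight_lt.
have tW : tpoly W = \sum_(l | K l) tconst v _ (a^-1 * f l) * tpoly (shear_poly v w l).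
  rewrite [LHS]rmorph_sum; apply: eq_bigr => l _.
  by rewrite [LHS]tpolyM tpolyC /twiden tate_substC.
split.
- split; last by rewrite WE size_polyDl.
  by apply/monicP; rewrite WE lead_coefDl // (monicP km).
- rewrite tW; apply: tnorm_sum => // l lK; rewrite tnormM tnormC absvalM absvalV.
  rewrite (eqP lK) va mulVf ?gt_eqF // mul1r.
  exact: (tnorm_shear_poly w_gt0 c1).
- rewrite tnormM tnormC absvalV va mulrC ltr_pdivrMr // mul1r.
  exact: le_lt_trans (tnorm_subst _ _) h0lt.
have aV : tconst v n.+1 a * tconst v _ a^-1 = 1.
  by rewrite -tconstM divff // tconst1.
have sW : tconst v _ a * tpoly W = sigma (\sum_(l | K l) tconst v _ (f l) * tmon v l).
  rewrite [RHS]rmorph_sum tW mulr_sumr; apply: eq_bigr => l _.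
  have sC c : sigma (tconst v _ c) = tconst v _ c := tate_substC _ c.
  rewrite [RHS]rmorphM mulrA -tconstM mulVKf //; congr (_ * _).
    exact/esym/sC.
  exact/esym/(shear_tmon w_gt0 c1 l).
have sB (x y : tate v n.+1) : sigma (x - y) = sigma x - sigma y := rmorphB sigma x y.
by rewrite mulrDr /h mulrA aV mul1r /h0 sB sW addrC subrK.
Qed.

(** Without variables T is the field of constants. Otherwise the sheared [f] is a unit times a
    Weierstrass polynomial, and its factorization is carried back by the inverse shear. *)
Lemma tate_factorial n : factorial_ring (tate v n).
Proof.
elim: n => [|n IH] f f0.
  exists 0%N => /=; suff fE : f = tconst v _ (f 0%MM).
    by rewrite fE tconst_unit //; apply: contra_neq f0 => e; rewrite fE e rmorph0.
  by apply: tate_eqP => k; rewrite tcoefC [k]nvar0_mnmE eqxx.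
have [s [t [a [d [W [h [sK tK a0 [[Wm Wd] W1 h1 sf]]]]]]]] := tate_distinguished f0.
have [W' [q [W'm W'1 qU W'E]]] := weierstrass_preparation v_complete Wm Wd W1 h1.
have [k kP] := nfactors_tpoly v_complete IH W'm W'1.
exists k; rewrite -[f]sK; apply: (nfactors_iso tK sK); rewrite sf.
have -> : tpoly W + h = q^-1 * tpoly W' by rewrite W'E mulKr.
by rewrite mulrA; apply: nfactors_unitl => //; rewrite unitrM tconst_unit // unitrV.
Qed.

End TateFactorial.

(** * Gluing along an exhaustion by polydiscs *)

Section PrimesAndMorphisms.
Variables (A A' : idomainType) (phi : {rmorphism A -> A'}).

Lemma divides_rmorph a b : divides a b -> divides (phi a) (phi b).
Proof. by case=> c ->; exists (phi c); rewrite rmorphM. Qed.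

Lemma associates_rmorph a b : associates a b -> associates (phi a) (phi b).
Proof. by case=> u uU ->; exists (phi u); rewrite ?rmorph_unit // rmorphM. Qed.

Lemma nonunit_image_prime k a : nfactors k a -> phi a \isn't a GRing.unit ->
  exists q, [/\ prime_elt q, divides q a & phi q \isn't a GRing.unit].
Proof.
elim: k a => [|k IH] a; first by move=> aU; rewrite rmorph_unit.
case=> p [b [pP bk ->]]; rewrite rmorphM unitrM negb_and => /orP[pU|/(IH _ bk)].
  by exists p; split=> //; apply/divides_mulr/divides_refl.
by case=> q [qP qb qU]; exists q; split=> //; apply: divides_mull.
Qed.

(** Used for restriction to a smaller polydisc: a prime seen there comes from a prime of the larger
    one. *)
Lemma prime_divides_image k a q : nfactors k a -> prime_elt q -> divides q (phi a) ->
  exists p, [/\ prime_elt p, divides p a & divides q (phi p)].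
Proof.
move=> ak qP; have [_ qU qdiv] := qP; elim: k a ak => [|k IH] a.
  by move=> aU /divides_unit/(_ (rmorph_unit phi aU)) qU'; rewrite qU' in qU.
case=> p [b [pP bk ->]]; rewrite rmorphM => /qdiv[qp|/(IH _ bk)].
  by exists p; split=> //; apply/divides_mulr/divides_refl.
by case=> p' [p'P p'b qp']; exists p'; split=> //; apply: divides_mull.
Qed.

(** A prime [p] is stripped from both [s] and [b]. As p^2 does not divide [s], the remaining primes
    of [s] are not associated to [p] and still divide what is left of [b]. *)
Lemma squarefree_divides k (s b : A) : nfactors k s ->
  (forall q, prime_elt q -> ~ divides (q ^+ 2) s) ->
  (forall q, prime_elt q -> divides q s -> divides q b) -> divides s b.
Proof.
elim: k s b => [|k IH] s b; first by move=> sU *; apply: unit_divides.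
case=> p [s' [pP s'k ->]] sF sb.
have [|b' bE] := sb p pP; first exact/divides_mulr/divides_refl.
have [q qP qs|q qP qs|c cE] := IH s' b' s'k.
- by apply: (sF q qP); apply: divides_mull.
- have := sb q qP (divides_mull _ qs); have [_ _ qdiv] := qP.
  rewrite bE mulrC => /qdiv[|//] qp; case: (sF p pP).
  have [x ->] := divides_trans (prime_divides_prime pP qP qp) qs.
  by exists x; rewrite expr2 mulrCA.
- by exists c; rewrite bE cE; ring.
Qed.

End PrimesAndMorphisms.

(** * Restriction to polydiscs as rescaling *)

Section Scaling.
Variables (R : realType) (F : fieldType) (v : nonarch_absval R F) (m : nat).

Definition ms_scale (a : F) (f : mseries m F) : mseries m F :=
  MSeries (fun k => f k * a ^+ mdeg k).

Fact ms_scale_zmod a : zmod_morphism (ms_scale a).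
Proof. by move=> f g; apply: mseriesP => k; rewrite /= mulrBl. Qed.

Fact ms_scale_monoid a : monoid_morphism (ms_scale a).
Proof.
split=> [|f g]; apply: mseriesP => k.
  rewrite /= -mdeg_eq0; have [->|_] := eqVneq (mdeg k) 0%N; last by rewrite mul0r.
  by rewrite mul1r.
rewrite -[LHS]/((f * g) k * a ^+ mdeg k) !mscoefM mulr_suml.
apply: eq_bigr => i /eqP kE /=.
rewrite [X in a ^+ X](congr1 (@mdeg m) kE) mdegD exprD; ring.
Qed.

Variables (c : F) (c_neq0 : c != 0) (c_ge1 : 1 <= v c).
Local Notation T := (tate v m).
Local Notation E := (entire_fun v m).

Fact rho_subproof n (f : E) : ms_scale (c ^+ n) f \in @tate_pred R F v m.
Proof.
have r0 : 0 < v (c ^+ n) by rewrite absval_gt0 expf_neq0.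
apply/tate_predP => e e0.
have [N fN] := entireP _ _ (ef_entire f) _ r0 e e0.
by exists N => k /fN /=; rewrite absvalM [v (_ ^+ mdeg k)]absvalX.
Qed.

Definition rho n (f : E) : T := Tate (rho_subproof n f).

Fact theta_subproof j (f : T) : ms_scale (c^-1 ^+ j) f \in @tate_pred R F v m.
Proof.
apply/tate_predP => e e0; have /tate_predP/(_ e e0)[N fN] := tateP f.
exists N => k /fN /=; apply: le_lt_trans; rewrite absvalM -[leRHS]mulr1.
by rewrite ler_wpM2l ?absval_ge0 // !absvalX !exprn_ile1 ?exprn_ge0 ?absval_ge0 //
  absvalV invf_le1 // (lt_le_trans ltr01).
Qed.

Definition theta j (f : T) : T := Tate (theta_subproof j f).

Lemma tcoef_rho n f k : rho n f k = f k * c ^+ n ^+ mdeg k. Proof. by []. Qed.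
Lemma tcoef_theta j f k : theta j f k = f k * c^-1 ^+ j ^+ mdeg k. Proof. by []. Qed.

Fact rho_zmod n : zmod_morphism (rho n).
Proof. by move=> f g; apply: val_inj; apply: (ms_scale_zmod (c ^+ n)). Qed.
Fact rho_monoid n : monoid_morphism (rho n).
Proof.
have [h1 hM] := ms_scale_monoid (c ^+ n).
by split=> [|f g]; apply: val_inj; [apply: h1|apply: hM].
Qed.
Fact theta_zmod j : zmod_morphism (theta j).
Proof. by move=> f g; apply: val_inj; apply: (ms_scale_zmod (c^-1 ^+ j)). Qed.
Fact theta_monoid j : monoid_morphism (theta j).
Proof.
have [h1 hM] := ms_scale_monoid (c^-1 ^+ j).
by split=> [|f g]; apply: val_inj; [apply: h1|apply: hM].
Qed.

HB.instance Definition _ n := GRing.isZmodMorphism.Build E T (rho n) (rho_zmod n).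
HB.instance Definition _ n := GRing.isMonoidMorphism.Build E T (rho n) (rho_monoid n).
HB.instance Definition _ j := GRing.isZmodMorphism.Build T T (theta j) (theta_zmod j).
HB.instance Definition _ j := GRing.isMonoidMorphism.Build T T (theta j) (theta_monoid j).

Lemma rhoB n f g : rho n (f - g) = rho n f - rho n g. Proof. exact: rmorphB. Qed.
Lemma rhoM n f g : rho n (f * g) = rho n f * rho n g. Proof. exact: rmorphM. Qed.
Lemma thetaM j f g : theta j (f * g) = theta j f * theta j g. Proof. exact: rmorphM. Qed.
Lemma thetaB j f g : theta j (f - g) = theta j f - theta j g. Proof. exact: rmorphB. Qed.
Lemma theta_1D j h : theta j (1 + h) = 1 + theta j h.
Proof. by rewrite rmorphD rmorph1. Qed.

Lemma theta_theta i j f : theta i (theta j f) = theta (i + j) f.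
Proof. by apply: tate_eqP => k; rewrite !tcoef_theta exprD exprMn; ring. Qed.

Lemma theta0 f : theta 0 f = f.
Proof. by apply: tate_eqP => k; rewrite tcoef_theta expr0 expr1n mulr1. Qed.

Lemma theta_rho j n f : theta j (rho (n + j) f) = rho n f.
Proof.
apply: tate_eqP => k; rewrite tcoef_theta !tcoef_rho exprD exprMn exprVn.
by rewrite exprVn -!mulrA divff ?mulr1 // !expf_neq0.
Qed.

Lemma thetaC j a : theta j (tconst v m a) = tconst v m a.
Proof.
apply: tate_eqP => k; rewrite tcoef_theta tcoefC -mdeg_eq0.
by have [->|_] := eqVneq (mdeg k) 0%N; rewrite ?expr0 ?mulr1 ?mul0r.
Qed.

Lemma rho_eq0 n f : (rho n f == 0) = (f == 0).
Proof.
apply/eqP/eqP => [f0|->]; last exact: rmorph0.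
apply/val_inj/mseriesP => k; apply/eqP.
have := congr1 (fun h : T => h k) f0; rewrite tcoef_rho tcoef0 => /eqP.
by rewrite mulf_eq0 orbC expf_eq0 expf_eq0 (negPf c_neq0) !andbF.
Qed.

Lemma tnorm_theta j f : tnorm (theta j f) <= tnorm f.
Proof.
apply: tnorm_le => k; apply: le_trans (tnorm_ub f k).
rewrite tcoef_theta absvalM -[leRHS]mulr1 ler_wpM2l ?absval_ge0 //.
by rewrite !absvalX !exprn_ile1 ?exprn_ge0 ?absval_ge0 //
  absvalV invf_le1 // (lt_le_trans ltr01).
Qed.

End Scaling.

(* For a trivial absolute value the Tate algebra is the polynomial ring, which
   is then also the ring of entire functions, and no rescaling is needed. *)
Definition scaling_factor (R : realType) (F : fieldType) (v : nonarch_absval R F) (c : F) :=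
  1 < v c \/ c = 1 /\ forall x, x != 0 -> v x = 1.

Lemma scaling_factor_ex (R : realType) (F : fieldType) (v : nonarch_absval R F) :
  exists c, scaling_factor v c.
Proof.
have [[c c1]|/forallNP nc] := pselect (exists c, 1 < v c); first by exists c; left.
have v1 x : v x <= 1 by rewrite leNgt; apply/negP/nc.
exists 1; right; split=> // x x0; apply/eqP; rewrite eq_le v1 /=.
by rewrite -invf_le1 ?absval_gt0 // -absvalV v1.
Qed.

Section Gluing.
Variables (R : realType) (F : fieldType) (v : nonarch_absval R F) (m : nat).
Hypothesis v_complete : absval_complete v.
Variables (c : F) (cP : scaling_factor v c).
Local Notation T := (tate v m).
Local Notation E := (entire_fun v m).

Lemma scaling_ge1 : 1 <= v c.
Proof. by case: cP => [/ltW//|[-> _]]; rewrite absval1. Qed.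

Lemma scaling_neq0 : c != 0.
Proof. by rewrite -(absval_gt0 v) (lt_le_trans ltr01) ?scaling_ge1. Qed.

Local Notation rho := (@rho R F v m c scaling_neq0).
Local Notation theta := (@theta R F v m c scaling_ge1).

(** The Schwarz lemma: without constant term every monomial has degree at least 1 and is scaled by
    at most |c|^-j. *)
Lemma theta_contracts : exists x : R, 0 <= x < 1 /\
  forall j (h : T), h 0%MM = 0 -> tnorm h < 1 -> tnorm (theta j h) <= x ^+ j.
Proof.
have [c1|[_ triv]] := cP.
  exists (v c)^-1; have c0 : 0 < v c by rewrite (lt_trans ltr01).
  have ci1 : (v c)^-1 <= 1 by rewrite invf_le1 // ltW.
  split=> [|j h h0 h1]; first by rewrite invr_ge0 invf_lt1 // absval_ge0.
  apply: tnorm_le => k; rewrite tcoef_theta.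
  have [->|k0] := eqVneq k 0%MM.
    by rewrite h0 mul0r absval0 exprn_ge0 // invr_ge0 absval_ge0.
  rewrite absvalM !absvalX absvalV -[leRHS]mul1r.
  rewrite ler_pM ?absval_ge0 ?exprn_ge0 ?invr_ge0 ?absval_ge0 //.
    exact: le_trans (tnorm_ub _ _) (ltW h1).
  have : (0 < mdeg k)%N by rewrite lt0n mdeg_eq0.
  case: (mdeg k) => // d _; rewrite exprS ler_piMr ?exprn_ge0 ?invr_ge0 ?absval_ge0 //.
  by rewrite !exprn_ile1 ?exprn_ge0 ?invr_ge0 ?absval_ge0.
(* For the trivial absolute value, norm below 1 forces [h] to be 0, so any ratio below 1 will do. *)
exists 2^-1; split=> [|j h h0 h1]; first by rewrite invr_ge0 ler0n invf_lt1 ?ltr0n ?ltr1n.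
suff -> : h = 0 by rewrite rmorph0 tnorm0 exprn_ge0 // invr_ge0.
apply: tate_eqP => k; apply/eqP; apply/negP => /negP/triv hk.
by have := le_lt_trans (tnorm_ub h k) h1; rewrite hk ltxx.
Qed.

(** All [g n] are rescalings of the one series [g 0], which therefore converges on every radius
    |c|^n. For the trivial absolute value it is a polynomial. *)
Lemma rho_lift (g : nat -> T) : (forall n, theta 1 (g n.+1) = g n) ->
  exists G : E, forall n, rho n G = g n.
Proof.
move=> gS; have gE n k : g n k = g 0%N k * c ^+ n ^+ mdeg k.
  elim: n => [|n IH]; first by rewrite expr1n mulr1.
  rewrite exprS exprMn mulrCA -IH -[g n]gS tcoef_theta expr1 exprVn.
  by rewrite mulrCA divff ?mulr1 // expf_neq0 // scaling_neq0.
suff GE : tate_series (g 0%N) \in entire v m.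
  by exists (EntireFun GE) => n; apply: tate_eqP => k; rewrite gE.
apply/entireP => r r0 e e0; have [c1|[_ triv]] := cP; last first.
  have /tate_predP/(_ 1 ltr01)[N gN] := tateP (g 0%N).
  exists N => k /gN gk; suff -> : g 0%N k = 0 by rewrite absval0 mul0r.
  by apply/eqP; apply/negP => /negP/triv e1; rewrite e1 ltxx in gk.
have c0 : 0 < v c by rewrite (lt_trans ltr01).
have [|n rn] := geometric_lt (x := (v c)^-1) r _ ltr01.
  by rewrite invr_ge0 invf_lt1 // absval_ge0.
have {}rn : r <= v c ^+ n.
  by move: rn; rewrite exprVn ltr_pdivrMr ?exprn_gt0 // mul1r => /ltW.
have /tate_predP/(_ e e0)[N gN] := tateP (g n).
exists N => k /gN; apply: le_lt_trans; rewrite (gE n) absvalM !absvalX.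
by rewrite ler_wpM2l ?absval_ge0 // lerXn2r ?nnegrE ?exprn_ge0 ?absval_ge0 // ltW.
Qed.

(** T is a domain, so the quotients on the polydiscs are unique, hence compatible, and they lift. *)
Lemma rho_divides (a b : E) : a != 0 -> (forall n, divides (rho n a) (rho n b)) ->
  divides a b.
Proof.
move=> a0 /choice[q qP]; have [|Q QE] := @rho_lift q.
  move=> n; have an0 : rho n a != 0 by rewrite rho_eq0.
  have rE f : rho n f = theta 1 (rho n.+1 f) by rewrite -[n.+1]addn1 theta_rho.
  by apply: (mulIf an0); rewrite -qP !rE -thetaM -qP.
exists Q; apply/eqP; rewrite -subr_eq0 -(rho_eq0 scaling_neq0 0).
by rewrite rhoB rhoM QE qP subrr.
Qed.

Lemma rho_unit (a : E) : (forall n, rho n a \is a GRing.unit) -> a \is a GRing.unit.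
Proof.
move=> aU; have a0 : a != 0.
  by rewrite -(rho_eq0 scaling_neq0 0); apply: contraTneq (aU 0%N) => ->; rewrite unitr0.
have [|b ba] := @rho_divides a 1 a0; first by move=> n; apply: unit_divides.
by apply/unitrP; exists b; split; [|rewrite mulrC]; apply/esym.
Qed.

(** On the n-th polydisc [a] is its constant term times 1 + h. Restricting to the unit polydisc
    bounds each nonconstant coefficient by a multiple of x^n, for every n. *)
Lemma entire_unit_constant (a : E) : a \is a GRing.unit -> ef_constant a.
Proof.
move=> aU k k0; have [x [x01 xP]] := theta_contracts.
apply/(absval_eq0 v)/eqP; rewrite eq_le absval_ge0 andbT.
apply: (geometric_le0 (C := v (a 0%MM)) x01) => n.
have [b [h [b0 h0 h1 hE]]] := tate_unitE (rmorph_unit (rho n) aU).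
have ab : a 0%MM = b.
  have := congr1 (fun f : T => f 0%MM) hE; rewrite tcoef_rho tcoefCM tcoefD tcoef1.
  by rewrite mdeg0 expr0 mulr1 eqxx h0 addr0 mulr1.
have aE : rho 0 a = tconst v m b * (1 + theta n h).
  by rewrite -(theta_rho scaling_neq0 scaling_ge1 n) [rho _ _]hE thetaM thetaC theta_1D.
have -> : a k = b * theta n h k.
  have := congr1 (fun f : T => f k) aE; rewrite tcoef_rho tcoefCM tcoefD tcoef1.
  by rewrite expr1n mulr1 (negPf k0) add0r.
rewrite absvalM ab ler_wpM2l ?absval_ge0 //.
exact: le_trans (tnorm_ub _ _) (xP _ _ h0 h1).
Qed.

(* Normalising the constants, theta g_{n+1} = (1 + h_n) g_n with |h_n| < 1 and
   h_n(0) = 0. By the Schwarz lemma [theta_contracts] the infinite products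
   V_n = (1 + h_n) (1 + theta h_{n+1}) (1 + theta^2 h_{n+2}) ... converge to
   units, and theta V_{n+1} (1 + h_n) = V_n makes the g_n V_n compatible. *)
Lemma rho_glue (g : nat -> T) : (forall n, associates (theta 1 (g n.+1)) (g n)) ->
  exists G : E, forall n, associates (rho n G) (g n).
Proof.
move=> gS; have /choice[a /choice[h ahP]] : forall n, exists a : F, exists h : T,
    [/\ a != 0, h 0%MM = 0, tnorm h < 1 & theta 1 (g n.+1) = tconst v m a * (1 + h) * g n].
  move=> n; have [u uU ->] := gS n; have [b [h [b0 h0 h1 ->]]] := tate_unitE uU.
  by exists b, h.
have [x [x01 xP]] := theta_contracts.
(* Chosen to absorb the constants: [b n.+1 * a n = b n]. *)
pose b n := \prod_(i < n) (a i)^-1.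
have b0 n : b n != 0.
  by apply/prodf_neq0 => i _; rewrite invr_eq0; have [] := ahP i.
have ba n : b n.+1 * a n = b n.
  by rewrite /b big_ord_recr /= mulfVK //; have [] := ahP n.
pose y n j := \prod_(i < j) (1 + theta i (h (n + i)%N)).
have h1 n i : tnorm (theta i (h n)) < 1.
  by apply: le_lt_trans (tnorm_theta _ _ _) _; have [] := ahP n.
have y1 n j : tnorm (y n j) <= 1.
  rewrite /y; elim: j => [|j IH]; first by rewrite big_ord0 tnorm1.
  by rewrite big_ord_recr tnormM /= tnorm_1D ?mulr1.
have yS n j : y n j.+1 = (1 + h n) * theta 1 (y n.+1 j).
  elim: j => [|j IH].
    by rewrite /y big_ord_recl !big_ord0 theta0 addn0 rmorph1.
  rewrite /y big_ord_recr -/(y n j.+1) IH /= -mulrA [in RHS]big_ord_recr -/(y n.+1 j) /=.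
  by rewrite thetaM theta_1D theta_theta add1n addSnnS.
have /choice[V VP] n : exists V : T, forall j, tnorm (V - y n j) <= 1 * x ^+ j.
  apply: (tate_complete v_complete x01) => // j.
  rewrite /y big_ord_recr -/(y n j) /= mulrDr mulr1 addrAC subrr add0r tnormM mul1r.
  rewrite -[leRHS]mul1r ler_pM ?tnorm_ge0 //.
  by have [_ h0 hlt _] := ahP (n + j)%N; apply: xP.
have Vtheta n : V n = (1 + h n) * theta 1 (V n.+1).
  apply/eqP; rewrite -subr_eq0; apply/eqP/(tnorm_lim_eq0 (C := 1) x01) => j.
  have -> : V n - (1 + h n) * theta 1 (V n.+1) =
      (V n - y n j.+1) - (1 + h n) * theta 1 (V n.+1 - y n.+1 j).
    by rewrite thetaB yS; ring.
  apply: tnormB_le.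
    apply: le_trans (VP _ _) _; rewrite !mul1r exprS; case/andP: x01 => x0 x1.
    by rewrite ler_piMl ?exprn_ge0 // ltW.
  have [_ _ hn _] := ahP n; rewrite tnormM tnorm_1D // mul1r.
  exact: le_trans (tnorm_theta _ _ _) (VP _ _).
(* The first partial product is 1 + h n, and [V n] differs from it by at most x < 1. *)
have Vunit n : V n \is a GRing.unit.
  have -> : V n = 1 + ((V n - y n 1%N) + h n).
    by rewrite /y big_ord_recl big_ord0 /= theta0 addn0; ring.
  apply: unit_1D => //; have [_ _ hn _] := ahP n.
  have x1 : x < 1 by case/andP: x01.
  have VPn := VP n 1%N; rewrite mul1r expr1 in VPn.
  apply: le_lt_trans (_ : Num.max x (tnorm (h n)) < 1); last by rewrite gt_max x1.
  by apply: tnormD_le; rewrite le_max ?VPn ?lexx ?orbT.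
have [|G GE] := @rho_lift (fun n => tconst v m (b n) * g n * V n).
  move=> n; rewrite !thetaM thetaC; have [_ _ _ ->] := ahP n.
  by rewrite [V n]Vtheta -(ba n) tconstM; ring.
exists G => n; exists (tconst v m (b n) * V n); last by rewrite GE mulrAC.
by rewrite unitrM tconst_unit // Vunit.
Qed.

(** The increasing case serves the radicals, the decreasing one the gcds with an irreducible
    element. *)
Lemma chain_glue (a : nat -> T) (f : E) : f != 0 -> (forall n, divides (a n) (rho n f)) ->
  (forall n, divides (a n) (theta 1 (a n.+1))) \/
  (forall n, divides (theta 1 (a n.+1)) (a n)) ->
  exists G : E, forall n, exists j0, forall j, (j0 <= j)%N ->
    associates (theta j (a (n + j)%N)) (rho n G).
Proof.
move=> f0 af mono.
have thetaS j x : theta j.+1 x = theta j (theta 1 x) by rewrite theta_theta addn1.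
have /choice[j0 j0P] n : exists j0, forall j, (j0 <= j)%N ->
    associates (theta j (a (n + j)%N)) (theta j0 (a (n + j0)%N)).
  have fn0 : rho n f != 0 by rewrite rho_eq0.
  apply: (divisor_chain_stationary (d := fun j => theta j (a (n + j)%N))
    (tate_factorial v_complete (n := m)) fn0) => [j|].
    by rewrite -(theta_rho scaling_neq0 scaling_ge1 j); apply: divides_rmorph.
  by case: mono => aS; [left|right] => j; rewrite thetaS addnS; apply: divides_rmorph.
have [|G GP] := @rho_glue (fun n => theta (j0 n) (a (n + j0 n)%N)).
  (* At this [j] both chains are stable, and restricting the j-th term at n + 1 gives the term j + 1
     at n. *)
  move=> n; pose j := maxn (j0 n) (j0 n.+1).
  have h := associates_sym (j0P n.+1 j (leq_maxr _ _)).
  have A1 : associates (theta 1 (theta (j0 n.+1) (a (n.+1 + j0 n.+1)%N)))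
    (theta 1 (theta j (a (n.+1 + j)%N))) := associates_rmorph (theta 1) h.
  apply: associates_trans A1 _; rewrite theta_theta add1n addSnnS.
  by apply: j0P; rewrite leqW // leq_maxl.
exists G => n; exists (j0 n) => j /j0P h.
exact: associates_trans h (associates_sym (GP n)).
Qed.

End Gluing.

(** * The square free part *)

Section SquareFreePart.
Variables (R : realType) (F : fieldType) (v : nonarch_absval R F) (m : nat).
Hypothesis v_complete : absval_complete v.
Variables (c : F) (cP : scaling_factor v c).
Local Notation T := (tate v m).
Local Notation E := (entire_fun v m).
Local Notation rho := (@rho R F v m c (scaling_neq0 cP)).
Local Notation theta := (@theta R F v m c (scaling_ge1 cP)).

Let factorialT : factorial_ring T := tate_factorial v_complete (n := m).

Let theta_rhoE j n f : theta j (rho (n + j) f) = rho n f.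
Proof. exact: theta_rho. Qed.

Let rho_neq0 n f : f != 0 -> rho n f != 0.
Proof. by rewrite rho_eq0. Qed.

Variables (f : E) (f_neq0 : f != 0) (s : nat -> T).
Hypotheses (s_dvd : forall n, divides (s n) (rho n f))
  (s_prime : forall n p, prime_elt p -> divides p (rho n f) -> divides p (s n))
  (s_sqf : forall n p, prime_elt p -> ~ divides (p ^+ 2) (s n)).

(** A prime of [s n] divides the restriction of some prime of f on the larger polydisc, and that
    prime divides [s (n + j)]. *)
Lemma radical_theta n j : divides (s n) (theta j (s (n + j)%N)).
Proof.
have sn0 : s n != 0 := divides_neq0 (s_dvd n) (rho_neq0 n f_neq0).
have [k sk] := factorialT sn0.
apply: squarefree_divides sk _ _ => [p pP|q qP /divides_trans qs]; first exact: s_sqf.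
have := qs _ (s_dvd n); rewrite -(theta_rhoE j n) => qf.
have [l fl] := factorialT (rho_neq0 (n + j) f_neq0).
have [p [pP pf qp]] := prime_divides_image fl qP qf.
by apply: divides_trans qp _; apply: divides_rmorph; apply: s_prime.
Qed.

Variable S : E.
Hypothesis S_lim : forall n, exists j0, forall j, (j0 <= j)%N ->
  associates (theta j (s (n + j)%N)) (rho n S).

Lemma radical_dvd_limit n : divides (s n) (rho n S).
Proof.
have [j /(_ j (leqnn j)) /associates_divides] := S_lim n.
exact/divides_trans/radical_theta.
Qed.

Let s_dvd_theta n j : divides (theta j (s (n + j)%N)) (rho n f).
Proof. by rewrite -(theta_rhoE j n); apply: divides_rmorph. Qed.

Lemma limit_dvd : divides S f.
Proof.
apply: (rho_divides (cP := cP)) => [|n].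
  have [j /(_ j (leqnn j)) h] := S_lim 0.
  rewrite -(rho_eq0 (scaling_neq0 cP) 0).
  apply: associates_neq0 (associates_sym h) _.
  exact: divides_neq0 (s_dvd_theta 0 j) (rho_neq0 0 f_neq0).
have [j /(_ j (leqnn j))/associates_sym/associates_divides h] := S_lim n.
exact: divides_trans h (s_dvd_theta n j).
Qed.

(* If the square of a prime q divides rho_m S = e s_m, with s_m square free, then
   q divides e, and e becomes a unit on the smaller polydisc. *)
Lemma limit_square_free : square_free S.
Proof.
move=> g g_nconst [x SE]; apply: g_nconst; apply: (entire_unit_constant cP).
(* As entire units are constant, a nonconstant [g] fails to be a unit on some polydisc [n]. *)
apply: (rho_unit (cP := cP)) => n; apply: contrapT => /negP gU.
have S0 : S != 0.
  have [y fE] := limit_dvd; apply: contra_neq f_neq0 => S0.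
  by rewrite fE S0 mulr0.
have [j /(_ j (leqnn j)) SL] := S_lim n; set k := (n + j)%N in SL.
have [e eE] := radical_dvd_limit k.
(* On polydisc [n] both [rho k S] and [s k] restrict to associates of [rho n S], so their quotient
   [e] becomes a unit. *)
have eU : theta j e \is a GRing.unit.
  have [u uU uE] := SL.
  have sn0 : theta j (s k) != 0 by apply: associates_neq0 SL _; apply: rho_neq0.
  have : theta j (s k) = u * theta j e * theta j (s k).
    by rewrite -mulrA -thetaM -eE theta_rhoE.
  rewrite -[X in X = _]mul1r => /(mulIf sn0)/esym ue.
  by apply/unitrP; exists u; split; rewrite // mulrC.
have g0 : g != 0 by apply: contra_neq S0 => g0; rewrite SE g0 expr0n mulr0.
have [l gl] := factorialT (rho_neq0 k g0).
rewrite -(theta_rhoE j n) in gU.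
have [q [qP [y gE] qU]] := nonunit_image_prime gl gU.
have [q0 _ qdiv] := qP.
have q2 : e * s k = rho k x * (y * q) ^+ 2.
  have gX : rho k (g ^+ 2) = rho k g ^+ 2 by exact: rmorphXn.
  by rewrite -eE SE rhoM gX gE.
have qe : divides q e -> False.
  move=> h; have h' : divides (theta j q) (theta j e) by apply: divides_rmorph.
  by case/negP: qU; apply: divides_unit h' eU.
(* [q] stays a nonunit on polydisc [n], so it cannot divide [e]; both factors [q] must come from
   [s k], which is square free. *)
have [|//|[t tE]] := qdiv e (s k).
  by exists (rho k x * y ^+ 2 * q); rewrite q2; ring.
have [|//|[t' t'E]] := qdiv e t.
  exists (rho k x * y ^+ 2); apply: (mulIf q0).
  by rewrite -mulrA -tE q2; ring.
by apply: (s_sqf (n := k) qP); exists t'; rewrite tE t'E; ring.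
Qed.

Lemma irreducible_dvd_limit P : irreducible_elt P -> divides P f -> divides P S.
Proof.
move=> [PU Pirr] Pf.
have P0 : P != 0 by apply: contra_neq f_neq0 => P0; case: Pf => x ->; rewrite P0 mulr0.
have /choice[d dP] n := gcd_ex (rho n S) factorialT (rho_neq0 n P0).
have dP_dvd n j : divides (theta j (d (n + j)%N)) (rho n P).
  by rewrite -(theta_rhoE j n); have [h _ _] := dP (n + j)%N; apply: divides_rmorph.
have dS_dvd n j : divides (theta j (d (n + j)%N)) (rho n S).
  by rewrite -(theta_rhoE j n); have [_ h _] := dP (n + j)%N; apply: divides_rmorph.
have [n||Q QL] := chain_glue v_complete (cP := cP) (a := d) P0.
- by have [] := dP n.
(* The restriction of [d n.+1] is a common divisor on polydisc [n], so it divides the gcd [d n]. *)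
- right=> n; have [_ _] := dP n; apply; rewrite -[n.+1]addn1.
    exact: dP_dvd.
  exact: dS_dvd.
have dvdQ n : divides (rho n Q) (rho n P) /\ divides (rho n Q) (rho n S).
  have [j /(_ j (leqnn j))/associates_sym/associates_divides h] := QL n.
  by split; apply: divides_trans h _; [apply: dP_dvd|apply: dS_dvd].
have Q0 : Q != 0.
  rewrite -(rho_eq0 (scaling_neq0 cP) 0).
  exact: divides_neq0 (dvdQ 0%N).1 (rho_neq0 0 P0).
have [x PE] : divides Q P.
  by apply: (rho_divides (cP := cP)) Q0 _ => n; apply: (dvdQ n).1.
have [y SE] : divides Q S.
  by apply: (rho_divides (cP := cP)) Q0 _ => n; apply: (dvdQ n).2.
(* If the cofactor [x] is a unit, [P] is associated to [Q] and divides [S]. It remains to exclude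
   that [Q] is a unit. *)
have [xU|QU] := Pirr x Q PE; first by exists (y * x^-1); rewrite SE PE mulrA divrK.
case/negP: PU; apply: (rho_unit (cP := cP)) => n; apply: contrapT => /negP PnU.
have [j /(_ j (leqnn j)) QLj] := QL n; set k := (n + j)%N in QLj.
have [l Pl] := factorialT (rho_neq0 k P0).
rewrite -(theta_rhoE j n) in PnU.
(* This prime of [P] survives restriction to polydisc [n]. It divides f, hence [s k], [S] and the
   gcd [d k], so its restriction divides [rho n Q], which would be a unit. *)
have [q [qP qPk qU]] := nonunit_image_prime Pl PnU.
have qd : divides q (d k).
  have [_ _] := dP k; apply=> //.
  apply: divides_trans (radical_dvd_limit k); apply: s_prime => //.
  by apply: divides_trans qPk _; case: Pf => z ->; exists (rho k z); rewrite rhoM.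
case/negP: qU; apply: (divides_unit _ (rmorph_unit (rho n) QU)).
have qdj : divides (theta j q) (theta j (d k)) by apply: divides_rmorph.
exact: divides_trans qdj (associates_divides QLj).
Qed.

End SquareFreePart.

Theorem theorem4p2 (R : realType) (F : closedFieldType)
    (v : nonarch_absval R F) (v_complete : absval_complete v)
    (m : nat) (f : entire_fun v m) (f_neq0 : f != 0) :
  exists S : entire_fun v m,
    square_free S /\
    forall P : entire_fun v m,
      irreducible_elt P -> (divides P S <-> divides P f).
Proof.
have [c cP] := scaling_factor_ex v.
have fn0 n : rho (scaling_neq0 cP) n f != 0 by rewrite rho_eq0.
have /choice[s sP] n := radical_ex (tate_factorial v_complete (n := m)) (fn0 n).
have s_dvd n : divides (s n) (rho (scaling_neq0 cP) n f) by have [] := sP n.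
have s_prime n p : prime_elt p -> divides p (rho (scaling_neq0 cP) n f) -> divides p (s n).
  by have [_ h _] := sP n; apply: h.
have s_sqf n p : prime_elt p -> ~ divides (p ^+ 2) (s n).
  by have [_ _ h] := sP n; apply: h.
have [|S SL] := chain_glue v_complete (cP := cP) f_neq0 s_dvd.
  by left=> n; rewrite -[n.+1]addn1; apply: (radical_theta v_complete f_neq0 s_dvd s_prime).
exists S; split; first exact: (limit_square_free v_complete f_neq0 s_dvd s_prime s_sqf SL).
move=> P Pirr; split=> [PS|].
  have [x fE] := limit_dvd f_neq0 s_dvd SL; case: PS => y SE.
  by exists (x * y); rewrite fE SE mulrA.
exact: (irreducible_dvd_limit v_complete f_neq0 s_dvd s_prime s_sqf SL).
Qed.
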